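(* Let $X$ be a complex Banach space and $k\in\mathbb{Z}$. The Hankel transform $\mathcal{H}_k$ maps $\mathscr S_{(k)}([0,\infty);X)$ into itself, and furthermore the identities $$\tilde{\mathcal D}_{-k+i}^{\,n-i}\tilde{\mathcal D}_k^{\,i}\mathcal{H}_k[f](\rho)=(-1)^{n-i}\mathcal{H}_{k+n-2i}[r^nf](\rho),$$ $$\mathcal{H}_{k+n-2i}\big[\mathcal{D}_{-k+i}^{\,n-i}\mathcal{D}_k^{\,i}f\big](\rho)=(-1)^{n-i}\rho^n\mathcal{H}_k[f](\rho)$$ hold for each $f\in\mathscr S_{(k)}([0,\infty);X)$ and $0\le i\le n$, $n\in\mathbb{N}_0$.
   Context: For $j\in\mathbb{Z}$, $\mathcal{D}_j:=\frac{\mathrm d}{\mathrm dr}+\frac jr$ and $\mathcal{D}_j^n:=\mathcal{D}_{j-(n-1)}\cdots\mathcal{D}_{j-1}\mathcal{D}_j$; $\tilde{\mathcal D}_j$, $\tilde{\mathcal D}_j^n$ denote the same operators with respect to $\rho$. $\mathscr S_{(k)}([0,\infty);X)$ is the set of $f:[0,\infty)\to X$ such that for all $0\le i\le n$, $n\in\mathbb{N}_0$, the function $\mathcal{D}_{-k+i}^{\,n-i}\mathcal{D}_k^{\,i}f$ belongs to $C^0([0,\infty);X)$ (after continuous extension to $r=0$), $(k+n-2i)\mathcal{D}_{-k+i}^{\,n-i}\mathcal{D}_k^{\,i}f|_{r=0}=0$, and $\sup_{r\ge0}r^l\|\mathcal{D}_{-k+i}^{\,n-i}\mathcal{D}_k^{\,i}f(r)\|<\infty$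 for all $l\in\mathbb{N}_0$. The $k$-index Hankel transform is $$\mathcal{H}_k[f](\rho):=\int_0^\infty f(r)J_k(\rho r)\,r\,\mathrm dr,$$ where $J_k$ is the $k$-index Bessel function of the first kind. *)

(* Defs.v *)
From Stdlib Require Import Reals ZArith Lra.
From Coquelicot Require Import Coquelicot.

Open Scope R_scope.

(** * Restriction of scalars

    Coquelicot derives and integrates functions [R -> V] only when [V] is a
    normed module over [R_AbsRing].  [realify X] is the complex Banach space [X]
    with the same addition, norm, balls and limits, and with
    [scal] restricted to real scalars. *)

Section Realify.

Variable X : CompleteNormedModule C_AbsRing.

Let rscal (a : R) (x : X) : X := scal (RtoC a : C_AbsRing) x.

Lemma rscal_assoc (a b : R) (u : X) : rscal a (rscal b u) = rscal (a * b) u.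
Proof.
  unfold rscal; rewrite RtoC_mult.
  exact (scal_assoc (RtoC a : C_AbsRing) (RtoC b) u).
Qed.

Lemma rscal_one (u : X) : rscal 1 u = u.
Proof. exact (scal_one u). Qed.

Lemma rscal_distr_l (a : R) (u v : X) :
  rscal a (plus u v) = plus (rscal a u) (rscal a v).
Proof. exact (scal_distr_l _ u v). Qed.

Lemma rscal_distr_r (a b : R) (u : X) :
  rscal (a + b) u = plus (rscal a u) (rscal b u).
Proof.
  unfold rscal; rewrite RtoC_plus.
  exact (scal_distr_r (RtoC a : C_AbsRing) (RtoC b) u).
Qed.

Definition realify_ModuleSpace_mixin :=
  ModuleSpace.Mixin R_Ring X rscal
    rscal_assoc rscal_one rscal_distr_l rscal_distr_r.

Definition realify_ModuleSpace : ModuleSpace R_Ring :=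
  ModuleSpace.Pack R_Ring X
    (ModuleSpace.Class R_Ring X (AbelianGroup.class X)
       realify_ModuleSpace_mixin) X.

Definition realify_NormedModuleAux : NormedModuleAux R_AbsRing :=
  NormedModuleAux.Pack R_AbsRing X
    (NormedModuleAux.Class R_AbsRing X
       (ModuleSpace.class R_Ring realify_ModuleSpace)
       (UniformSpace.class X)) X.

Lemma realify_norm_scal (a : R) (x : X) :
  norm (rscal a x) <= Rabs a * norm x.
Proof.
  unfold rscal; rewrite <- Cmod_R.
  exact (norm_scal (RtoC a : C_AbsRing) x).
Qed.

Definition realify_NormedModule_mixin :=
  NormedModule.Mixin R_AbsRing realify_NormedModuleAux
    (fun x : X => norm x) (@norm_factor C_AbsRing X)
    norm_triangle realify_norm_scal norm_compat1 norm_compat2 norm_eq_zero.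

Definition realify_NormedModule : NormedModule R_AbsRing :=
  NormedModule.Pack R_AbsRing X
    (NormedModule.Class R_AbsRing X
       (NormedModuleAux.class R_AbsRing realify_NormedModuleAux)
       realify_NormedModule_mixin) X.

Definition realify : CompleteNormedModule R_AbsRing :=
  CompleteNormedModule.Pack R_AbsRing X
    (CompleteNormedModule.Class R_AbsRing X
       (NormedModule.class R_AbsRing realify_NormedModule)
       (CompleteNormedModule.mixin C_AbsRing X
          (CompleteNormedModule.class C_AbsRing X))) X.

End Realify.

(** * Bessel functions of integer order

    [J_k x = sum_m (-1)^m / (m! Gamma (m+k+1)) (x/2)^(2m+k)].  For [m + k < 0]
    the factor [1 / Gamma (m+k+1)] is [0]; otherwise
    [Gamma (m+k+1) = (m+k)!] and [2m+k >= 0]. *)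

Definition bessel_J (k : Z) (x : R) : R :=
  Series (fun m : nat =>
    if (0 <=? Z.of_nat m + k)%Z
    then (-1) ^ m
         / (INR (fact m) * INR (fact (Z.to_nat (Z.of_nat m + k))))
         * (x / 2) ^ Z.to_nat (2 * Z.of_nat m + k)
    else 0).

(** * The operators [D_j] and the spaces [S_(k)]

    A function on [[0, oo)] is represented by a function on [R] whose values
    on the negative half-line are never used. *)

Section Operators.

Context {V : CompleteNormedModule R_AbsRing}.

(** Meaningful only where [ex_derive f r] holds. *)
Definition deriv (f : R -> V) (r : R) : V := iota (fun v => is_derive f r v).

(** Meaningful at [r = 0] only if [f] has a right limit there. *)
Definition extend0 (f : R -> V) (r : R) : V :=
  if Rlt_dec 0 r then f r
  else iota (fun v => filterlim f (at_right 0) (locally v)).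

Definition D (j : Z) (f : R -> V) : R -> V :=
  extend0 (fun r => plus (deriv f r) (scal (IZR j / r) (f r))).

(** [Dpow j n f = D_(j-(n-1)) (... (D_(j-1) (D_j f)))] *)
Fixpoint Dpow (j : Z) (n : nat) (f : R -> V) : R -> V :=
  match n with
  | O => f
  | S m => D (j - Z.of_nat m) (Dpow j m f)
  end.

(** [Dmix k n i f = D_(-k+i)^(n-i) (D_k^i f)], used for [i <= n]. *)
Definition Dmix (k : Z) (n i : nat) (f : R -> V) : R -> V :=
  Dpow (- k + Z.of_nat i) (n - i) (Dpow k i f).

(** Every derivative taken in [Dmix k n i f] is a derivative of some
    [Dmix k n' i' f] with [i' <= n' < n], so the differentiability clause,
    imposed for all [i <= n], says exactly that all the functions
    [Dmix k n i f] are defined on [(0, oo)]. *)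
Definition schwartz (k : Z) (f : R -> V) : Prop :=
  forall n i : nat, (i <= n)%nat ->
    (forall r : R, 0 < r -> ex_derive (Dmix k n i f) r) /\
    continuous_on (fun r : R => 0 <= r) (Dmix k n i f) /\
    scal (IZR (k + Z.of_nat n - 2 * Z.of_nat i)) (Dmix k n i f 0) = zero /\
    (forall l : nat, exists M : R, forall r : R, 0 <= r ->
       r ^ l * norm (Dmix k n i f r) <= M).

(** * The Hankel transform *)

Definition hankel_integrand (k : Z) (f : R -> V) (rho r : R) : V :=
  scal (bessel_J k (rho * r) * r) (f r).

(** Absolute convergence, as for a Bochner integral. *)
Definition hankel_integrable (k : Z) (f : R -> V) (rho : R) : Prop :=
  ex_RInt_gen (hankel_integrand k f rho) (at_point 0) (Rbar_locally p_infty) /\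
  ex_RInt_gen (fun r => norm (hankel_integrand k f rho r))
    (at_point 0) (Rbar_locally p_infty).

(** Meaningful only where [hankel_integrable k f rho] holds. *)
Definition hankel (k : Z) (f : R -> V) (rho : R) : V :=
  RInt_gen (hankel_integrand k f rho) (at_point 0) (Rbar_locally p_infty).

End Operators.

(* Main.v *)
(** The function [f |-> H_k f] is smooth because the Bessel functions of integer
    order are bounded together with all their derivatives: a Taylor bound
    [|J_k y - J_k x - (y - x) J_k' x| <= C (y - x)^2], integrated against the
    rapidly decreasing [f], differentiates [H_k f] under the integral sign.  The
    contiguity relations [J_k' +- (k/x) J_k = +- J_(k -+ 1)] then give
    [D_k H_k f = H_(k-1) (r f)] and [D_(-k) H_k f = - H_(k+1) (r f)], while
    integration by parts gives [H_(k-1) (D_k f) = rho H_k f] and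
    [H_(k+1) (D_(-k) f) = - rho H_k f]; both families of identities follow by
    iteration.  For the decay of [D_(-k+i)^(n-i) D_k^i H_k f = +- H_m (r^n f)],
    one checks that [r^n f] admits arbitrarily many operators
    [D_m], [D_(m-1)], ..., and uses
    [rho^l H_m g = H_(m-l) (D_(m-l+1) ... D_m g)]. *)

(* [Defs] comes last because Coquelicot also defines a constant [D]. *)
From Stdlib Require Import Reals ZArith Lia Lra Psatz.
From Coquelicot Require Import Coquelicot.
Require Import Defs.
Open Scope R_scope.

(** * Bessel functions of integer order *)

(* Coquelicot's lemmas yield equations at carriers merely convertible to [R],
   which [ring] and [field] reject. *)
Ltac eq_R := match goal with |- ?a = ?b => change (@eq R a b) end.

(** The singular coefficient [j / r] shapes the argument. Identities for [D_j] are verified only at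
    [r > 0], as equations for a derivative, and reach [r = 0] because the right-hand side is already
    known to be continuous on the closed half-line. Functions count only through their values on
    [r >= 0], so these identities are pointwise equalities there and pass through further operators
    by extensionality lemmas. All integrals are controlled by one comparison function,
    [C / (1 + r)^2], whose primitive is explicit: it gives existence, uniform bounds, the error term
    in the differentiation under the integral sign, and the absence of a contribution from [r = 0]
    in the integration by parts. The vanishing condition at [r = 0] in the definition of the target
    space comes from [J_m(0) = 0] for [m <> 0]. *)

Definition bessel_coef (n m : nat) : R :=
  (-1) ^ m / (INR (fact m) * INR (fact (m + n))).

(** What remains of [J_n x] after removing [(x/2)^n], as a power series in [t = (x/2)^2]; it is the
    hypergeometric function [0F1(; n+1; -t) / n!]. *)
Definition bessel_entire (n : nat) (t : R) : R := PSeries (bessel_coef n) t.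

Lemma bessel_coef_succ (n m : nat) :
  INR (S m) * INR (S m + n) * bessel_coef n (S m) = - bessel_coef n m.
Proof.
  unfold bessel_coef; change (S m + n)%nat with (S (m + n)).
  rewrite !fact_simpl, !mult_INR, <- tech_pow_Rmult.
  pose proof (INR_fact_lt_0 m); pose proof (INR_fact_lt_0 (m + n)).
  pose proof (lt_0_INR (S m) ltac:(lia)).
  pose proof (lt_0_INR (S (m + n)) ltac:(lia)).
  field; lra.
Qed.

(** The quotient of successive coefficients is [- 1 / ((m+1) (m+1+n))], of modulus at most
    [1 / (m+1)]. *)
Lemma CV_radius_bessel_coef (n : nat) : CV_radius (bessel_coef n) = p_infty.
Proof.
  assert (Hnz : forall m, bessel_coef n m <> 0).
  { intros m; unfold bessel_coef, Rdiv.
    apply Rmult_integral_contrapositive_currified.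
    - apply pow_nonzero; lra.
    - apply Rinv_neq_0_compat, Rmult_integral_contrapositive_currified;
        apply INR_fact_neq_0. }
  apply CV_radius_infinite_DAlembert; [exact Hnz|].
  apply is_lim_seq_le_le with (u := fun _ => 0) (w := fun m => / INR (S m)).
  - intros m; split; [apply Rabs_pos|].
    pose proof (bessel_coef_succ n m) as H; specialize (Hnz m).
    assert (H1 : 1 <= INR (S m)) by (rewrite S_INR; pose proof (pos_INR m); lra).
    assert (H2 : 1 <= INR (S m + n)) by (rewrite plus_INR; pose proof (pos_INR n); lra).
    replace (bessel_coef n (S m) / bessel_coef n m)
      with (- (/ INR (S m) * / INR (S m + n))).
    2:{ replace (bessel_coef n m) with
          (- (INR (S m) * INR (S m + n) * bessel_coef n (S m))) in Hnz |- * by lra.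
        assert (bessel_coef n (S m) <> 0) by (intros E; apply Hnz; rewrite E; ring).
        field; repeat split; lra. }
    rewrite Rabs_Ropp, Rabs_pos_eq.
    + rewrite <- (Rmult_1_r (/ INR (S m))) at 2.
      apply Rmult_le_compat_l; [apply Rlt_le, Rinv_0_lt_compat; lra|].
      rewrite <- Rinv_1; apply Rinv_le_contravar; lra.
    + apply Rlt_le, Rmult_lt_0_compat; apply Rinv_0_lt_compat; lra.
  - apply is_lim_seq_const.
  - replace (Finite 0) with (Rbar_inv p_infty) by reflexivity.
    apply is_lim_seq_inv; [|discriminate].
    apply -> is_lim_seq_incr_1; apply is_lim_seq_INR.
Qed.

Lemma bessel_coef_in_disk (n : nat) (t : R) :
  Rbar_lt (Rabs t) (CV_radius (bessel_coef n)).
Proof. rewrite CV_radius_bessel_coef; exact I. Qed.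

Lemma is_derive_bessel_entire (n : nat) (t : R) :
  is_derive (bessel_entire n) t (- bessel_entire (S n) t).
Proof.
  replace (- bessel_entire (S n) t) with (PSeries (PS_derive (bessel_coef n)) t).
  { apply is_derive_PSeries, bessel_coef_in_disk. }
  unfold bessel_entire; rewrite <- PSeries_opp; apply PSeries_ext; intros m.
  unfold PS_derive, PS_opp, bessel_coef.
  replace (m + S n)%nat with (S m + n)%nat by lia.
  rewrite (fact_simpl m), mult_INR, <- tech_pow_Rmult.
  pose proof (INR_fact_lt_0 m); pose proof (INR_fact_lt_0 (S m + n)).
  pose proof (lt_0_INR (S m) ltac:(lia)).
  change (@opp _ ?a) with (Ropp a).
  field; lra.
Qed.

(** Over the common denominator [m! (m+n+1)!], the coefficients of [t^m] compare by
    [(m+n+1) - m = n+1]. Both the three-term recurrence and the derivative formula for [J_k] come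
    from this identity. *)
Lemma bessel_entire_rec (n : nat) (t : R) :
  bessel_entire n t + t * bessel_entire (S (S n)) t
  = INR (S n) * bessel_entire (S n) t.
Proof.
  unfold bessel_entire; rewrite <- PSeries_incr_1, <- PSeries_scal.
  rewrite <- PSeries_plus.
  2:{ apply CV_radius_inside, bessel_coef_in_disk. }
  2:{ apply ex_pseries_incr_1, CV_radius_inside, bessel_coef_in_disk. }
  apply PSeries_ext; intros m.
  unfold PS_plus, PS_scal, PS_incr_1, bessel_coef.
  eq_R.
  repeat change (@scal _ _ ?a ?b) with (Rmult a b).
  change (@plus _ ?a ?b) with (Rplus a b).
  destruct m as [|m].
  - change (@zero _) with 0.
    replace (0 + S n)%nat with (S n) by lia; replace (0 + n)%nat with n by lia.
    rewrite (fact_simpl n), mult_INR.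
    pose proof (INR_fact_lt_0 n); pose proof (lt_0_INR (S n) ltac:(lia)).
    simpl (fact 0); simpl (INR 1); simpl pow; field; lra.
  - replace (m + S (S n))%nat with (S (S m + n)) by lia.
    replace (S m + S n)%nat with (S (S m + n)) by lia.
    rewrite (fact_simpl (S m + n)), (fact_simpl m), !mult_INR, <- tech_pow_Rmult.
    pose proof (INR_fact_lt_0 m); pose proof (INR_fact_lt_0 (S m + n)).
    pose proof (lt_0_INR (S m) ltac:(lia)).
    pose proof (lt_0_INR (S (S m + n)) ltac:(lia)) as HS.
    replace (INR (S n)) with (INR (S (S m + n)) - INR (S m))
      by (rewrite !S_INR, plus_INR, S_INR; ring).
    field; lra.
Qed.

Lemma bessel_J_of_nat (n : nat) (x : R) :
  bessel_J (Z.of_nat n) x = (x / 2) ^ n * bessel_entire n ((x / 2) ^ 2).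
Proof.
  unfold bessel_J, bessel_entire, PSeries; rewrite <- Series_scal_l.
  apply Series_ext; intros m; unfold bessel_coef.
  rewrite (proj2 (Z.leb_le 0 _)) by lia.
  replace (Z.to_nat (Z.of_nat m + Z.of_nat n)) with (m + n)%nat by lia.
  replace (Z.to_nat (2 * Z.of_nat m + Z.of_nat n)) with (n + 2 * m)%nat by lia.
  rewrite pow_add, (pow_mult _ 2); ring.
Qed.

(** The first [n] terms of the series of order [-n] vanish, being those where [1 / Gamma] is zero;
    shifting the index by [n] produces the sign. *)
Lemma bessel_J_opp_of_nat (n : nat) (x : R) :
  bessel_J (- Z.of_nat n) x = (-1) ^ n * bessel_J (Z.of_nat n) x.
Proof.
  unfold bessel_J; rewrite <- Series_scal_l, (Series_incr_n_aux _ n).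
  2:{ intros m Hm; rewrite (proj2 (Z.leb_gt 0 _)); [reflexivity|lia]. }
  apply Series_ext; intros m.
  rewrite !(proj2 (Z.leb_le 0 _)) by lia.
  replace (Z.to_nat (Z.of_nat (n + m) + - Z.of_nat n)) with m by lia.
  replace (Z.to_nat (2 * Z.of_nat (n + m) + - Z.of_nat n)) with (2 * m + n)%nat by lia.
  replace (Z.to_nat (Z.of_nat m + Z.of_nat n)) with (n + m)%nat by lia.
  replace (Z.to_nat (2 * Z.of_nat m + Z.of_nat n)) with (2 * m + n)%nat by lia.
  rewrite pow_add; field; split; apply INR_fact_neq_0.
Qed.

Lemma bessel_J_cases (k : Z) :
  exists (n : nat) (s : R), Rabs s = 1 /\ (k = Z.of_nat n \/ k = (- Z.of_nat n)%Z) /\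
    forall x, bessel_J k x = s * bessel_J (Z.of_nat n) x.
Proof.
  destruct (Z_le_gt_dec 0 k).
  - exists (Z.to_nat k), 1; rewrite Rabs_R1, !Z2Nat.id by lia.
    repeat split; auto; intros; ring.
  - exists (Z.to_nat (- k)), ((-1) ^ Z.to_nat (- k)).
    split; [|split; [lia|]].
    + apply pow_1_abs.
    + intros x; rewrite <- bessel_J_opp_of_nat, Z2Nat.id by lia.
      now replace (- - k)%Z with k by lia.
Qed.

Lemma bessel_J_at_0 (k : Z) : k <> 0%Z -> bessel_J k 0 = 0.
Proof.
  intros Hk; destruct (bessel_J_cases k) as (n & s & _ & Hn & E).
  rewrite E, bessel_J_of_nat; destruct n as [|n]; [exfalso; lia|].
  replace (0 / 2) with 0 by field; simpl pow; ring.
Qed.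

Lemma bessel_J_0_at_0 : bessel_J 0 0 = 1.
Proof.
  rewrite (bessel_J_of_nat 0); unfold bessel_entire.
  replace ((0 / 2) ^ 2) with 0 by field; rewrite PSeries_0.
  unfold bessel_coef; simpl; field.
Qed.

Lemma bessel_J_recurrence (k : Z) (x : R) :
  2 * IZR k * bessel_J k x = x * (bessel_J (k - 1) x + bessel_J (k + 1) x).
Proof.
  assert (Hnat : forall n : nat,
    2 * IZR (Z.of_nat (S n)) * bessel_J (Z.of_nat (S n)) x
    = x * (bessel_J (Z.of_nat n) x + bessel_J (Z.of_nat (S (S n))) x)).
  { intros n; rewrite !bessel_J_of_nat, <- INR_IZR_INZ, <- !tech_pow_Rmult.
    pose proof (bessel_entire_rec n ((x / 2) ^ 2)) as H.
    rewrite <- !tech_pow_Rmult in H; simpl (_ ^ 0) in H |- *.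
    set (u := x / 2) in *; replace x with (2 * u) by (unfold u; field).
    transitivity (2 * u * u ^ n *
      (INR (S n) * bessel_entire (S n) (u * (u * 1)))); [ring|].
    rewrite <- H; ring. }
  destruct (Z.lt_trichotomy k 0) as [Hk|[->|Hk]].
  - set (n := Z.to_nat (- k - 1)).
    replace (k - 1)%Z with (- Z.of_nat (S (S n)))%Z by lia.
    replace (k + 1)%Z with (- Z.of_nat n)%Z by lia.
    replace k with (- Z.of_nat (S n))%Z by lia.
    rewrite !bessel_J_opp_of_nat, opp_IZR, <- !tech_pow_Rmult.
    transitivity ((-1) ^ n * (2 * IZR (Z.of_nat (S n)) * bessel_J (Z.of_nat (S n)) x));
      [ring|rewrite Hnat; ring].
  (* At order [0] both sides vanish, since [J_(-1) = - J_1]. *)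
  - change (0 - 1)%Z with (- Z.of_nat 1)%Z; change (0 + 1)%Z with (Z.of_nat 1).
    rewrite bessel_J_opp_of_nat; simpl; ring.
  - set (n := Z.to_nat (k - 1)).
    replace (k - 1)%Z with (Z.of_nat n) by lia.
    replace (k + 1)%Z with (Z.of_nat (S (S n))) by lia.
    replace k with (Z.of_nat (S n)) by lia.
    apply Hnat.
Qed.

Lemma is_derive_value (f : R -> R) (x l l' : R) :
  is_derive f x l -> l = l' -> is_derive f x l'.
Proof. now intros H <-. Qed.

(** The symmetric form has no division by [x], so it also holds at [x = 0]; combined with the
    recurrence it gives both contiguity relations. *)
Lemma is_derive_bessel_J (k : Z) (x : R) :
  is_derive (bessel_J k) x ((bessel_J (k - 1) x - bessel_J (k + 1) x) / 2).
Proof.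
  assert (Hent : forall (n : nat) (y : R), is_derive (fun z => bessel_entire n ((z / 2) ^ 2)) y
      (- (y / 2) * bessel_entire (S n) ((y / 2) ^ 2))).
  { intros n y; eapply is_derive_value.
    - apply (is_derive_comp (bessel_entire n) (fun z : R => (z / 2) ^ 2));
        [apply is_derive_bessel_entire|].
      auto_derive; [trivial|reflexivity].
    - change (@scal _ _ ?a ?b) with (Rmult a b); field. }
  assert (Hnat : forall n : nat,
    is_derive (bessel_J (Z.of_nat (S n))) x
      ((bessel_J (Z.of_nat n) x - bessel_J (Z.of_nat (S (S n))) x) / 2)).
  { intros n.
    apply is_derive_ext with
      (fun y => (y / 2) ^ S n * bessel_entire (S n) ((y / 2) ^ 2)).
    { intros y; symmetry; apply bessel_J_of_nat. }
    rewrite !bessel_J_of_nat.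
    eapply is_derive_value.
    - apply Derive.is_derive_mult; [|apply Hent].
      apply is_derive_pow with (f := fun y => y / 2) (l := / 2).
      auto_derive; [trivial|field].
    - simpl Init.Nat.pred; rewrite <- !tech_pow_Rmult.
      pose proof (bessel_entire_rec n ((x / 2) ^ 2)) as H.
      rewrite <- !tech_pow_Rmult in H; simpl (_ ^ 0) in H |- *.
      set (u := x / 2) in *.
      transitivity (u ^ n / 2 *
        (INR (S n) * bessel_entire (S n) (u * (u * 1))
         - 2 * (u * (u * 1)) * bessel_entire (S (S n)) (u * (u * 1)))); [field|].
      rewrite <- H; field. }
  destruct (Z.lt_trichotomy k 0) as [Hk|[->|Hk]].
  - set (n := Z.to_nat (- k - 1)).
    replace (k - 1)%Z with (- Z.of_nat (S (S n)))%Z by lia.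
    replace (k + 1)%Z with (- Z.of_nat n)%Z by lia.
    replace k with (- Z.of_nat (S n))%Z by lia.
    apply is_derive_ext with (fun y => (-1) ^ S n * bessel_J (Z.of_nat (S n)) y).
    { intros y; symmetry; apply bessel_J_opp_of_nat. }
    rewrite !bessel_J_opp_of_nat.
    eapply is_derive_value; [apply is_derive_scal, Hnat|rewrite <- !tech_pow_Rmult; field].
  - change (0 - 1)%Z with (- Z.of_nat 1)%Z; change (0 + 1)%Z with (Z.of_nat 1).
    apply is_derive_ext with (fun y => bessel_entire 0 ((y / 2) ^ 2)).
    { intros y; rewrite (bessel_J_of_nat 0); simpl; ring. }
    rewrite bessel_J_opp_of_nat, bessel_J_of_nat.
    eapply is_derive_value; [apply Hent|simpl; field].
  - set (n := Z.to_nat (k - 1)).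
    replace (k - 1)%Z with (Z.of_nat n) by lia.
    replace (k + 1)%Z with (Z.of_nat (S (S n))) by lia.
    replace k with (Z.of_nat (S n)) by lia.
    apply Hnat.
Qed.

(** * Boundedness of the Bessel functions on the real line *)

Lemma Rabs_bessel_J_opp (k : Z) (x : R) : Rabs (bessel_J k (- x)) = Rabs (bessel_J k x).
Proof.
  destruct (bessel_J_cases k) as (n & s & _ & _ & E).
  rewrite !E, !bessel_J_of_nat, !Rabs_mult, <- !RPow_abs.
  unfold Rdiv; rewrite Ropp_mult_distr_l_reverse, Rabs_Ropp.
  now replace ((- (x * / 2)) ^ 2) with ((x * / 2) ^ 2) by ring.
Qed.

(* [(J_0^2 + J_1^2)' = - 2 J_1^2 / x] is nonpositive on the positive half-line. *)
Lemma bessel_energy_le_1 (x : R) : 0 <= x ->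
  bessel_J 0 x ^ 2 + bessel_J 1 x ^ 2 <= 1.
Proof.
  intros Hx.
  set (E := fun y => bessel_J 0 y ^ 2 + bessel_J 1 y ^ 2).
  assert (HE : forall y, is_derive E y
    (bessel_J 1 y * (- bessel_J 0 y - bessel_J 2 y))).
  { intros y.
    assert (H0 : is_derive (bessel_J 0) y (- bessel_J 1 y)).
    { eapply is_derive_value; [apply is_derive_bessel_J|].
      change (0 - 1)%Z with (- Z.of_nat 1)%Z; rewrite bessel_J_opp_of_nat.
      simpl; field. }
    pose proof (is_derive_bessel_J 1 y : is_derive _ _ ((bessel_J 0 y - bessel_J 2 y) / 2)) as H1.
    eapply is_derive_value.
    - apply (is_derive_plus (fun y => bessel_J 0 y ^ 2) (fun y => bessel_J 1 y ^ 2));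
        apply is_derive_pow; eassumption.
    - change (@plus _ ?a ?b) with (Rplus a b); simpl; field. }
  assert (HEx : E 0 = 1).
  { unfold E; rewrite bessel_J_0_at_0, bessel_J_at_0 by discriminate; ring. }
  destruct (MVT_gen E 0 x (fun y => bessel_J 1 y * (- bessel_J 0 y - bessel_J 2 y)))
    as (c & Hc & Heq).
  { intros y _; apply HE. }
  { intros y _; apply continuity_pt_filterlim, (ex_derive_continuous E); eexists; apply HE. }
  rewrite Rmin_left, Rmax_right in Hc by lra.
  fold (E x).
  assert (bessel_J 1 c * (- bessel_J 0 c - bessel_J 2 c) <= 0).
  { pose proof (bessel_J_recurrence 1 c) as H; simpl in H.
    destruct (Req_dec c 0) as [->|Hc0].
    - rewrite (bessel_J_at_0 1) by discriminate; lra.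
    - assert (c > 0) by lra.
      apply Rmult_le_reg_l with c; [lra|].
      replace (c * (bessel_J 1 c * (- bessel_J 0 c - bessel_J 2 c)))
        with (- bessel_J 1 c * (c * (bessel_J 0 c + bessel_J 2 c))) by ring.
      rewrite <- H; nra. }
  nra.
Qed.

(* The recurrence propagates the bound from [J_0] and [J_1] on [x >= 1];
   on [0 <= x <= 1] continuity suffices. *)
Lemma bessel_J_bounded_nat (n : nat) :
  exists C, forall x, Rabs (bessel_J (Z.of_nat n) x) <= C.
Proof.
  assert (Hcomp : forall m, exists C, forall x, 0 <= x <= 1 -> Rabs (bessel_J m x) <= C).
  { intros m; destruct (continuity_ab_maj (fun x => Rabs (bessel_J m x)) 0 1)
      as (c & Hc & _); [lra| |eexists; exact Hc].
    intros x _; apply continuity_pt_filterlim.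
    apply (continuous_comp (bessel_J m) Rabs); [|apply continuous_Rabs].
    apply (ex_derive_continuous (bessel_J m)); eexists; apply is_derive_bessel_J. }
  assert (Hpos : exists C, forall x, 0 <= x -> Rabs (bessel_J (Z.of_nat n) x) <= C).
  (* The recurrence has three terms, so two consecutive orders are bounded together. *)
  { enough (exists C, forall x, 0 <= x ->
      Rabs (bessel_J (Z.of_nat n) x) <= C /\ Rabs (bessel_J (Z.of_nat (S n)) x) <= C)
      as [C HC] by (exists C; intros; now apply HC).
    induction n as [|n [C HC]].
    - exists 1; intros x Hx; pose proof (bessel_energy_le_1 x Hx).
      change (Z.of_nat 0) with 0%Z; change (Z.of_nat 1) with 1%Z.
      pose proof (pow2_ge_0 (bessel_J 0 x)); pose proof (pow2_ge_0 (bessel_J 1 x)).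
      split; apply Rabs_le; split; nra.
    - destruct (Hcomp (Z.of_nat (S (S n)))) as [C' HC'].
      (* [C'] serves on [[0, 1]]; for [x > 1] the last entry bounds
         [J_(n+2) = 2 (n+1) J_(n+1) / x - J_n]. *)
      exists (Rmax C (Rmax C' (2 * INR (S n) * C + C))); intros x Hx; split.
      { eapply Rle_trans; [now apply HC|apply Rmax_l]. }
      eapply Rle_trans; [|apply Rmax_r].
      destruct (Rle_lt_dec x 1) as [Hx1|Hx1].
      { eapply Rle_trans; [apply HC'; lra|apply Rmax_l]. }
      eapply Rle_trans; [|apply Rmax_r].
      pose proof (bessel_J_recurrence (Z.of_nat (S n)) x) as H.
      replace (Z.of_nat (S n) - 1)%Z with (Z.of_nat n) in H by lia.
      replace (Z.of_nat (S n) + 1)%Z with (Z.of_nat (S (S n))) in H by lia.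
      rewrite <- INR_IZR_INZ in H.
      replace (bessel_J (Z.of_nat (S (S n))) x) with
        (2 * INR (S n) * (bessel_J (Z.of_nat (S n)) x * / x) - bessel_J (Z.of_nat n) x).
      2:{ apply Rmult_eq_reg_l with x; [|lra]; field_simplify; lra. }
      destruct (HC x Hx) as [Ha Hb].
      assert (Hq : Rabs (bessel_J (Z.of_nat (S n)) x * / x) <= C).
      { rewrite Rabs_mult, (Rabs_pos_eq (/ x)) by (apply Rlt_le, Rinv_0_lt_compat; lra).
        rewrite <- (Rmult_1_r C); apply Rmult_le_compat; trivial using Rabs_pos.
        - apply Rlt_le, Rinv_0_lt_compat; lra.
        - rewrite <- Rinv_1; apply Rinv_le_contravar; lra. }
      apply Rabs_le_between in Ha; apply Rabs_le_between in Hq; apply Rabs_le.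
      pose proof (pos_INR (S n)); nra. }
  destruct Hpos as [C HC]; exists C; intros x.
  destruct (Rle_lt_dec 0 x) as [Hx|Hx]; [now apply HC|].
  rewrite <- Rabs_bessel_J_opp; apply HC; lra.
Qed.

Lemma bessel_J_bounded (k : Z) : exists C, 0 <= C /\ forall x, Rabs (bessel_J k x) <= C.
Proof.
  destruct (bessel_J_cases k) as (n & s & Hs & _ & E).
  destruct (bessel_J_bounded_nat n) as [C HC]; exists C.
  split; [eapply Rle_trans; [apply Rabs_pos|apply (HC 0)]|].
  intros x; rewrite E, Rabs_mult, Hs, Rmult_1_l; apply HC.
Qed.

Lemma continuous_bessel_J (k : Z) (x : R) : continuous (bessel_J k) x.
Proof. apply (ex_derive_continuous (bessel_J k)); eexists; apply is_derive_bessel_J. Qed.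

(** * Improper integrals on the half-line *)

Local Notation continuous_on_halfline f := (continuous_on (fun r : R => 0 <= r) f).

Local Notation is_RInt_halfline h l :=
  (is_RInt_gen h (at_point 0) (Rbar_locally p_infty) l).

Lemma minus_minus_cancel {G : AbelianGroup} (u v : G) : minus u (minus u v) = v.
Proof.
  unfold minus at 1; rewrite opp_minus; unfold minus.
  rewrite plus_comm, <- plus_assoc, plus_opp_l; apply plus_zero_r.
Qed.

Lemma eq_of_minus_zero {G : AbelianGroup} (u v : G) : minus u v = zero -> u = v.
Proof.
  intros E; rewrite <- (minus_minus_cancel u v), E.
  symmetry; apply minus_zero_r.
Qed.

Section Halfline.

Context {V : CompleteNormedModule R_AbsRing}.

Definition rapid (g : R -> V) : Prop :=
  forall l : nat, exists M, forall r, 0 <= r -> r ^ l * norm (g r) <= M.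

Lemma norm_scal_le (a : R) (v : V) : norm (scal a v) <= Rabs a * norm v.
Proof. exact (norm_scal a v). Qed.

(** The axiom of a normed module is only [<=]; the converse is the same inequality for the scalar
    [/ a]. *)
Lemma norm_scal_eq (a : R) (v : V) : norm (scal a v) = Rabs a * norm v.
Proof.
  apply Rle_antisym; [apply norm_scal_le|].
  destruct (Req_dec a 0) as [->|Ha].
  { rewrite Rabs_R0, Rmult_0_l; apply norm_ge_0. }
  assert (E : v = scal (/ a) (scal a v)).
  { rewrite (@scal_assoc _ V); change (@mult _ ?x ?y) with (Rmult x y).
    rewrite Rinv_l by trivial; symmetry; exact (scal_one v). }
  rewrite E at 1; apply Rle_trans with (Rabs a * (Rabs (/ a) * norm (scal a v))).
  - apply Rmult_le_compat_l; [apply Rabs_pos|apply norm_scal_le].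
  - rewrite <- Rmult_assoc, <- Rabs_mult, Rinv_r, Rabs_R1, Rmult_1_l by trivial.
    apply Rle_refl.
Qed.

Lemma norm_minus_le (u v : V) : norm (minus u v) <= norm u + norm v.
Proof. rewrite <- (norm_opp v); exact (norm_triangle u (opp v)). Qed.

(** Extending [f] by the constant [f 0] to the left turns continuity on the closed half-line into
    continuity everywhere; [Rmax 0] is 1-Lipschitz. *)
Lemma continuous_on_Rmax (f : R -> V) (x : R) :
  continuous_on_halfline f -> continuous (fun r => f (Rmax 0 r)) x.
Proof.
  intros Hf.
  apply filterlim_comp with (within (fun r => 0 <= r) (locally (Rmax 0 x)));
    [|apply Hf, Rmax_l].
  intros P [d Hd]; exists d; intros y Hy.
  apply Hd; [|apply Rmax_l].
  change (Rabs (Rmax 0 y - Rmax 0 x) < d).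
  change (Rabs (y - x) < d) in Hy.
  revert Hy; unfold Rabs, Rmax; repeat destruct Rcase_abs; repeat destruct Rle_dec; lra.
Qed.

Lemma continuous_pos_of_halfline (f : R -> V) (r : R) :
  continuous_on_halfline f -> 0 < r -> continuous f r.
Proof.
  intros Hf Hr; apply (continuous_continuous_on (fun x => 0 <= x)); trivial.
  apply filter_imp with (fun x => 0 < x); [intros; lra|].
  now apply open_gt.
Qed.

Lemma continuous_on_halfline_scal (a : R -> R) (f : R -> V) :
  (forall x, continuous a x) -> continuous_on_halfline f ->
  continuous_on_halfline (fun r => scal (a r) (f r)).
Proof.
  intros Ha Hf.
  apply continuous_on_ext with (fun r => scal (a r) (f (Rmax 0 r))).
  { intros r Hr; now rewrite Rmax_right. }
  apply continuous_on_forall; intros x _.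
  apply (continuous_scal a (fun r => f (Rmax 0 r))); [apply Ha|now apply continuous_on_Rmax].
Qed.

Lemma continuous_on_halfline_plus (f g : R -> V) :
  continuous_on_halfline f -> continuous_on_halfline g ->
  continuous_on_halfline (fun r => plus (f r) (g r)).
Proof.
  intros Hf Hg.
  apply continuous_on_ext with (fun r => plus (f (Rmax 0 r)) (g (Rmax 0 r))).
  { intros r Hr; now rewrite Rmax_right. }
  apply continuous_on_forall; intros x _.
  apply (continuous_plus (fun r => f (Rmax 0 r)) (fun r => g (Rmax 0 r)));
    now apply continuous_on_Rmax.
Qed.

Lemma ex_RInt_of_halfline (f : R -> V) (a b : R) :
  continuous_on_halfline f -> 0 <= a <= b -> ex_RInt f a b.
Proof.
  intros Hf Hab; apply ex_RInt_ext with (fun r => f (Rmax 0 r)).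
  - rewrite Rmin_left, Rmax_right by lra; intros r Hr; rewrite Rmax_right; trivial; lra.
  - apply (@ex_RInt_continuous V); intros; now apply continuous_on_Rmax.
Qed.

(** The comparison function of all the estimates: not singular at [0], with primitive
    [- C / (1 + r)] and total mass [C]. *)
Lemma is_RInt_inv_square (C a b : R) : 0 <= a <= b ->
  is_RInt (fun r => C / (1 + r) ^ 2) a b (C / (1 + a) - C / (1 + b)).
Proof.
  intros Hab.
  replace (C / (1 + a) - C / (1 + b)) with (minus (- C / (1 + b)) (- C / (1 + a))).
  2:{ eq_R; change (@minus _ ?a ?b) with (a - b); field; lra. }
  apply (@is_RInt_derive R_CompleteNormedModule (fun r => - C / (1 + r))).
  - rewrite Rmin_left, Rmax_right by lra; intros x Hx.
    auto_derive; [lra|field; lra].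
  - rewrite Rmin_left, Rmax_right by lra; intros x Hx.
    apply (ex_derive_continuous (fun r => C / (1 + r) ^ 2)).
    auto_derive; apply Rgt_not_eq, Rmult_lt_0_compat; lra.
Qed.

Lemma norm_is_RInt_dominated (h : R -> V) (C a b : R) (l : V) :
  (forall r, 0 <= r -> norm (h r) <= C / (1 + r) ^ 2) -> 0 <= a <= b ->
  is_RInt h a b l -> norm l <= C / (1 + a) - C / (1 + b).
Proof.
  intros Hh Hab Hl.
  refine (norm_RInt_le h (fun r => C / (1 + r) ^ 2) a b l _ _ _ Hl _); [lra| |].
  - intros r Hr; apply Hh; lra.
  - now apply is_RInt_inv_square.
Qed.

Lemma dominated_const_nonneg (h : R -> V) (C : R) :
  (forall r, 0 <= r -> norm (h r) <= C / (1 + r) ^ 2) -> 0 <= C.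
Proof.
  intros Hh; specialize (Hh 0 (Rle_refl 0)).
  pose proof (norm_ge_0 (h 0)); replace (C / (1 + 0) ^ 2) with C in Hh by field; lra.
Qed.

(** Cauchy criterion in [V]: integrals up to [u] and up to [v >= u] differ by at most [C / (1 + u)],
    which is below [eps] once [u > C / eps]. *)
Lemma ex_RInt_halfline (h : R -> V) (C : R) :
  continuous_on_halfline h ->
  (forall r, 0 <= r -> norm (h r) <= C / (1 + r) ^ 2) ->
  exists l, is_RInt_halfline h l.
Proof.
  intros Hc Hd; pose proof (dominated_const_nonneg h C Hd) as HC.
  apply (filterlimi_locally_cauchy (fun ab : R * R => is_RInt h (fst ab) (snd ab))).
  { apply Filter_prod with (fun a => a = 0) (fun b => 0 < b).
    - reflexivity.
    - now exists 0.
    - intros a b -> Hb; split.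
      + eexists; apply RInt_correct, ex_RInt_of_halfline; trivial; simpl; lra.
      + intros y1 y2 H1 H2; rewrite <- (is_RInt_unique _ _ _ _ H1).
        now apply is_RInt_unique. }
  intros eps.
  exists (fun ab : R * R => fst ab = 0 /\ C / eps < snd ab); split.
  { apply Filter_prod with (fun a => a = 0) (fun b => C / eps < b); auto.
    - reflexivity.
    - now exists (C / eps). }
  assert (Hceps : 0 <= C / eps).
  { apply Rmult_le_pos; trivial; apply Rlt_le, Rinv_0_lt_compat, eps. }
  assert (Hmain : forall u v lu lv, C / eps < u -> u <= v ->
    is_RInt h 0 u lu -> is_RInt h 0 v lv -> norm (minus lv lu) < eps).
  { intros u v lu lv Hu Huv Hlu Hlv.
    apply Rle_lt_trans with (C / (1 + u)).
    - apply Rle_trans with (C / (1 + u) - C / (1 + v)).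
      + apply norm_is_RInt_dominated with h; trivial; [lra|].
        unfold minus; rewrite plus_comm; apply is_RInt_Chasles with 0; trivial.
        now apply is_RInt_swap.
      + assert (0 <= C / (1 + v)); [|lra].
        apply Rmult_le_pos; trivial; apply Rlt_le, Rinv_0_lt_compat; lra.
    - destruct eps as [e He]; simpl in *.
      apply Rmult_lt_reg_r with (1 + u); [lra|].
      replace (C / (1 + u) * (1 + u)) with (C / e * e) by (field; lra); nra. }
  intros [a u] [a' v]; simpl; intros [-> Hu] [-> Hv] lu lv Hlu Hlv.
  destruct (Rle_lt_dec u v).
  - exact (norm_compat1 lu lv eps (Hmain u v lu lv Hu r Hlu Hlv)).
  - apply ball_sym.
    exact (norm_compat1 lv lu eps (Hmain v u lv lu Hv (Rlt_le _ _ r) Hlv Hlu)).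
Qed.

(** The bound may depend on the upper limit: a constant [u] gives the domination estimate, and a [u]
    tending to [0] makes the integral vanish in the integration by parts. *)
Lemma norm_RInt_halfline_le_lim (h : R -> V) (u : R -> R) (c : R) (l : V) :
  is_RInt_halfline h l ->
  (forall b z, 0 < b -> is_RInt h 0 b z -> norm z <= u b) ->
  is_lim u p_infty c -> norm l <= c.
Proof.
  intros Hl Hu Hlim; apply le_epsilon; intros e He.
  assert (Hf : 0 < @norm_factor _ V) by apply norm_factor_gt_0.
  (* Balls and norm agree only up to [norm_factor]; the other half of [e] goes to the limit of
     [u]. *)
  assert (Hd : 0 < e / 2 / @norm_factor _ V) by (apply Rdiv_lt_0_compat; lra).
  pose proof (proj1 (filterlimi_locally _ _) Hl (mkposreal _ Hd)) as [Q R HQ [M HR] HQR].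
  apply is_lim_spec in Hlim.
  assert (He2 : 0 < e / 2) by lra.
  destruct (Hlim (mkposreal _ He2)) as [M' HM']; simpl in HM'.
  set (b := Rmax 0 (Rmax M M') + 1).
  assert (Hb : 0 < b /\ M < b /\ M' < b).
  { unfold b; pose proof (Rmax_l 0 (Rmax M M')); pose proof (Rmax_r 0 (Rmax M M')).
    pose proof (Rmax_l M M'); pose proof (Rmax_r M M'); lra. }
  destruct (HQR 0 b HQ (HR b (proj1 (proj2 Hb)))) as (z & Hz & Hball).
  specialize (Hu b z (proj1 Hb) Hz); specialize (HM' b (proj2 (proj2 Hb))).
  apply norm_compat2 in Hball; simpl in Hball.
  replace (norm_factor * (e / 2 / norm_factor)) with (e / 2) in Hball by (field; lra).
  apply Rabs_lt_between in HM'.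
  rewrite <- (minus_minus_cancel z l).
  eapply Rle_trans; [apply norm_minus_le|]; lra.
Qed.

Lemma norm_RInt_halfline_le (h : R -> V) (C : R) (l : V) :
  (forall r, 0 <= r -> norm (h r) <= C / (1 + r) ^ 2) ->
  is_RInt_halfline h l -> norm l <= C.
Proof.
  intros Hd Hl; pose proof (dominated_const_nonneg h C Hd) as HC.
  apply norm_RInt_halfline_le_lim with h (fun _ => C); trivial; [|apply is_lim_const].
  intros b z Hb Hz.
  apply Rle_trans with (C / (1 + 0) - C / (1 + b)).
  - apply norm_is_RInt_dominated with h; trivial; lra.
  - assert (0 <= C / (1 + b)).
    { apply Rmult_le_pos; trivial; apply Rlt_le, Rinv_0_lt_compat; lra. }
    replace (C / (1 + 0)) with C by field; lra.
Qed.

Lemma RInt_halfline_ext (f g : R -> V) (l : V) :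
  (forall r, 0 <= r -> f r = g r) -> is_RInt_halfline f l -> is_RInt_halfline g l.
Proof.
  intros E; apply is_RInt_gen_ext.
  apply Filter_prod with (fun a => a = 0) (fun b => 0 < b);
    [reflexivity|now exists 0|].
  intros a b -> Hb r; simpl; rewrite Rmin_left by lra; intros; apply E; lra.
Qed.

Lemma rapid_ext (f g : R -> V) :
  (forall r, 0 <= r -> f r = g r) -> rapid f -> rapid g.
Proof.
  intros E Hf l; destruct (Hf l) as [M HM]; exists M; intros r Hr.
  rewrite <- E by trivial; auto.
Qed.

Lemma rapid_scal (a : R -> R) (C : R) (n : nat) (g : R -> V) :
  (forall r, 0 <= r -> Rabs (a r) <= C * r ^ n) -> rapid g ->
  rapid (fun r => scal (a r) (g r)).
Proof.
  intros Ha Hg l; destruct (Hg (l + n)%nat) as [M HM].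
  exists (Rabs C * M); intros r Hr.
  apply Rle_trans with (Rabs C * (r ^ (l + n) * norm (g r)));
    [|apply Rmult_le_compat_l; [apply Rabs_pos|auto]].
  rewrite pow_add.
  replace (Rabs C * (r ^ l * r ^ n * norm (g r)))
    with (r ^ l * (Rabs C * r ^ n * norm (g r))) by ring.
  apply Rmult_le_compat_l; [now apply pow_le|].
  eapply Rle_trans; [apply norm_scal_le|].
  apply Rmult_le_compat_r; [apply norm_ge_0|].
  eapply Rle_trans; [now apply Ha|].
  apply Rmult_le_compat_r; [now apply pow_le|apply Rle_abs].
Qed.

Lemma rapid_plus (f g : R -> V) :
  rapid f -> rapid g -> rapid (fun r => plus (f r) (g r)).
Proof.
  intros Hf Hg l; destruct (Hf l) as [M HM], (Hg l) as [M' HM'].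
  exists (M + M'); intros r Hr; specialize (HM r Hr); specialize (HM' r Hr).
  eapply Rle_trans.
  - apply Rmult_le_compat_l; [now apply pow_le|exact (norm_triangle (f r) (g r))].
  - lra.
Qed.

(** Since [(1 + r)^2 = 1 + 2 r + r^2], the bounds for the exponents [n], [n+1], [n+2] add up to the
    constant [M0 + 2 M1 + M2]. *)
Lemma rapid_pow_dominated (n : nat) (g : R -> V) : rapid g ->
  exists C, 0 <= C /\ forall r, 0 <= r -> r ^ n * norm (g r) <= C / (1 + r) ^ 2.
Proof.
  intros Hg.
  destruct (Hg n) as [M0 H0], (Hg (S n)) as [M1 H1], (Hg (S (S n))) as [M2 H2].
  enough (Hd : forall r, 0 <= r -> r ^ n * norm (g r) <= (M0 + 2 * M1 + M2) / (1 + r) ^ 2).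
  { exists (M0 + 2 * M1 + M2); split; [|exact Hd].
    specialize (Hd 0 (Rle_refl 0)).
    pose proof (norm_ge_0 (g 0)); pose proof (pow_le 0 n (Rle_refl 0)).
    unfold Rdiv in Hd; rewrite Rplus_0_r, pow1, Rinv_1 in Hd; nra. }
  intros r Hr; specialize (H0 r Hr); specialize (H1 r Hr); specialize (H2 r Hr).
  assert (0 < (1 + r) ^ 2) by (apply pow_lt; lra).
  apply Rmult_le_reg_r with ((1 + r) ^ 2); trivial.
  replace ((M0 + 2 * M1 + M2) / (1 + r) ^ 2 * (1 + r) ^ 2) with (M0 + 2 * M1 + M2)
    by (field; lra).
  simpl in H1, H2; set (t := r ^ n) in *.
  replace (t * norm (g r) * (1 + r) ^ 2) with
    (t * norm (g r) + 2 * (r * t * norm (g r)) + r * (r * t) * norm (g r)) by ring; lra.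
Qed.

Lemma rapid_dominated (g : R -> V) : rapid g ->
  exists C, forall r, 0 <= r -> norm (g r) <= C / (1 + r) ^ 2.
Proof.
  intros Hg; destruct (rapid_pow_dominated 0 g Hg) as (C & _ & HC).
  exists C; intros r Hr; rewrite <- (Rmult_1_l (norm (g r))); exact (HC r Hr).
Qed.

(** * Uniqueness of derivatives and a criterion for differentiability *)

(** Needed to evaluate the [iota] in [deriv]. The zero function [f - f] has derivative [l - l'], so
    an increment [d / 2] gives [(d / 2) |l - l'| <= e (d / 2)] for every [e > 0]. *)
Lemma is_derive_vec_unique (f : R -> V) (x : R) (l l' : V) :
  is_derive f x l -> is_derive f x l' -> l = l'.
Proof.
  intros H H'.
  pose proof (is_derive_minus f f x l l' H H') as [_ Hd].
  specialize (Hd x (fun P HP => HP)).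
  apply eq_of_minus_zero, (norm_eq_zero (minus l l')); apply Rle_antisym; [|apply norm_ge_0].
  apply le_epsilon; intros e He; rewrite Rplus_0_l.
  destruct (Hd (mkposreal e He)) as [d Hdd].
  assert (Hd2 : 0 < d / 2) by (pose proof (cond_pos d); lra).
  specialize (Hdd (x + d / 2)).
  assert (Hb : ball x d (x + d / 2)).
  { change (Rabs (x + d / 2 - x) < d); rewrite Rabs_pos_eq; lra. }
  specialize (Hdd Hb); simpl in Hdd.
  change (@minus _ (x + d / 2) x) with (x + d / 2 - x) in Hdd.
  replace (x + d / 2 - x) with (d / 2) in Hdd by ring.
  change (norm (d / 2)) with (Rabs (d / 2)) in Hdd.
  rewrite (Rabs_pos_eq (d / 2)) in Hdd by lra.
  rewrite !minus_eq_zero, <- norm_opp, opp_minus, minus_zero_r in Hdd.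
  assert (Hs : norm (scal (d / 2) (minus l l')) <= e * (d / 2)) by exact Hdd.
  rewrite norm_scal_eq, Rabs_pos_eq in Hs by lra.
  apply Rmult_le_reg_l with (d / 2); trivial; lra.
Qed.

Lemma is_derive_of_quadratic (F : R -> V) (x : R) (l : V) (C : R) :
  (forall y, norm (minus (minus (F y) (F x)) (scal (y - x) l)) <= C * (y - x) ^ 2) ->
  is_derive F x l.
Proof.
  intros HF; split; [apply is_linear_scal_l|].
  intros x' Hx'.
  rewrite <- (@is_filter_lim_locally_unique R_AbsRing R_NormedModule x x' Hx').
  intros [e He].
  (* Adding [1] keeps the denominator positive when [C = 0]. *)
  assert (Hd : 0 < e / (Rabs C + 1)).
  { apply Rdiv_lt_0_compat; trivial; pose proof (Rabs_pos C); lra. }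
  exists (mkposreal _ Hd); intros y Hy; simpl pos.
  change (Rabs (y - x) < e / (Rabs C + 1)) in Hy.
  eapply Rle_trans; [apply HF|].
  change (norm (minus y x)) with (Rabs (y - x)).
  rewrite <- pow2_abs; pose proof (Rle_abs C); pose proof (Rabs_pos C).
  pose proof (Rabs_pos (y - x)).
  assert (Rabs (y - x) * (Rabs C + 1) <= e).
  { apply Rmult_le_reg_r with (/ (Rabs C + 1)); [apply Rinv_0_lt_compat; lra|].
    rewrite Rmult_assoc, Rinv_r by lra; unfold Rdiv in Hy; lra. }
  nra.
Qed.

End Halfline.

(** * Differentiation of the Hankel transform *)

Lemma scal_lincomb {M : ModuleSpace R_Ring} (a b c d : R) (v : M) :
  minus (minus (scal a v) (scal b v)) (scal d (scal c v)) = scal (a - b - d * c) v.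
Proof.
  rewrite scal_assoc, <- !scal_minus_distr_r; reflexivity.
Qed.

Lemma is_derive_bessel_J_scaled (k : Z) (rho r : R) :
  is_derive (fun r => bessel_J k (rho * r)) r
    (rho * ((bessel_J (k - 1) (rho * r) - bessel_J (k + 1) (rho * r)) / 2)).
Proof.
  eapply is_derive_value.
  - apply (is_derive_comp (bessel_J k) (fun r => rho * r)); [apply is_derive_bessel_J|].
    auto_derive; [trivial|reflexivity].
  - change (@scal _ _ ?a ?b) with (Rmult a b); ring.
Qed.

Lemma continuous_bessel_J_scaled (k : Z) (rho x : R) :
  continuous (fun r => bessel_J k (rho * r)) x.
Proof.
  apply (ex_derive_continuous (fun r => bessel_J k (rho * r))).
  eexists; apply is_derive_bessel_J_scaled.
Qed.

Lemma continuous_bessel_J_weight (k : Z) (rho : R) (n : nat) (x : R) :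
  continuous (fun r => bessel_J k (rho * r) * r ^ n) x.
Proof.
  apply (continuous_mult (fun r => bessel_J k (rho * r)) (fun r => r ^ n)).
  - apply continuous_bessel_J_scaled.
  - apply (ex_derive_continuous (fun r => r ^ n)); auto_derive; trivial.
Qed.

(** The second derivative is a combination of Bessel functions of orders [k-2], [k], [k+2], hence
    bounded, and the mean value theorem applies twice. A constant valid for all [x], [y] lets the
    estimate be used at [rho r] uniformly in [r]. *)
Lemma bessel_J_taylor (k : Z) : exists C, 0 <= C /\ forall x y,
  Rabs (bessel_J k y - bessel_J k x
        - (y - x) * ((bessel_J (k - 1) x - bessel_J (k + 1) x) / 2)) <= C * (y - x) ^ 2.
Proof.
  set (J' := fun z => (bessel_J (k - 1) z - bessel_J (k + 1) z) / 2).
  destruct (bessel_J_bounded (k - 1 - 1)) as (C1 & HC1 & H1).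
  destruct (bessel_J_bounded (k - 1 + 1)) as (C2 & HC2 & H2).
  destruct (bessel_J_bounded (k + 1 - 1)) as (C3 & HC3 & H3).
  destruct (bessel_J_bounded (k + 1 + 1)) as (C4 & HC4 & H4).
  assert (HJ' : forall x y, Rabs (J' y - J' x) <= (C1 + C2 + C3 + C4) * Rabs (y - x)).
  { intros x y.
    apply bounded_variation with (fun z =>
      ((bessel_J (k - 1 - 1) z - bessel_J (k - 1 + 1) z) / 2
       - (bessel_J (k + 1 - 1) z - bessel_J (k + 1 + 1) z) / 2) / 2).
    intros t _; split.
    - apply is_derive_ext with (fun z => / 2 * (bessel_J (k - 1) z - bessel_J (k + 1) z)).
      { intros z; eq_R; unfold J'; field. }
      eapply is_derive_value.
      + apply is_derive_scal, (is_derive_minus (bessel_J (k - 1)) (bessel_J (k + 1)));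
          apply is_derive_bessel_J.
      + eq_R; change (@minus _ ?a ?b) with (a - b); field.
    - specialize (H1 t); specialize (H2 t); specialize (H3 t); specialize (H4 t).
      apply Rabs_le_between in H1, H2, H3, H4; apply Rabs_le; lra. }
  exists (C1 + C2 + C3 + C4); split; [lra|]; intros x y; fold (J' x).
  destruct (MVT_gen (bessel_J k) x y J') as (c & Hc & ->).
  { intros z _; apply is_derive_bessel_J. }
  { intros z _; apply continuity_pt_filterlim, continuous_bessel_J. }
  replace (J' c * (y - x) - (y - x) * J' x) with ((y - x) * (J' c - J' x)) by ring.
  rewrite Rabs_mult, <- pow2_abs.
  assert (Rabs (c - x) <= Rabs (y - x)).
  { revert Hc; unfold Rmin, Rmax; destruct Rle_dec; intros Hc;
      unfold Rabs; repeat destruct Rcase_abs; lra. }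
  apply Rle_trans with (Rabs (y - x) * ((C1 + C2 + C3 + C4) * Rabs (y - x))); [|right; ring].
  apply Rmult_le_compat_l; [apply Rabs_pos|].
  eapply Rle_trans; [apply HJ'|]; apply Rmult_le_compat_l; lra.
Qed.

Section Hankel.

Context {V : CompleteNormedModule R_AbsRing}.

Lemma ex_RInt_weighted (a : R -> R) (C : R) (n : nat) (f : R -> V) :
  (forall x, continuous a x) -> (forall r, 0 <= r -> Rabs (a r) <= C * r ^ n) ->
  continuous_on_halfline f -> rapid f ->
  exists l, is_RInt_halfline (fun r => scal (a r) (f r)) l.
Proof.
  intros Ha HC Hf Hr.
  destruct (rapid_dominated _ (rapid_scal a C n f HC Hr)) as (M & HM).
  apply ex_RInt_halfline with M; trivial.
  now apply continuous_on_halfline_scal.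
Qed.

Lemma hankel_integrand_rapid (k : Z) (f : R -> V) (rho : R) :
  rapid f -> rapid (hankel_integrand k f rho).
Proof.
  intros Hf; destruct (bessel_J_bounded k) as (C & HC & HJ).
  apply rapid_scal with C 1%nat; trivial; intros r Hr.
  rewrite Rabs_mult, (Rabs_pos_eq r), pow_1 by trivial; apply Rmult_le_compat_r; auto.
Qed.

Lemma hankel_integrand_continuous (k : Z) (f : R -> V) (rho : R) :
  continuous_on_halfline f -> continuous_on_halfline (hankel_integrand k f rho).
Proof.
  intros Hf; apply continuous_on_halfline_scal; trivial; intros x.
  apply continuous_ext with (fun r => bessel_J k (rho * r) * r ^ 1).
  { intros; now rewrite pow_1. }
  apply continuous_bessel_J_weight.
Qed.

Lemma hankel_integrable_rapid (k : Z) (f : R -> V) (rho : R) :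
  continuous_on_halfline f -> rapid f -> hankel_integrable k f rho.
Proof.
  intros Hf Hr; pose proof (hankel_integrand_continuous k f rho Hf) as Hc.
  destruct (rapid_dominated _ (hankel_integrand_rapid k f rho Hr)) as (C & HC).
  split; [now apply ex_RInt_halfline with C|].
  apply (@ex_RInt_halfline R_CompleteNormedModule _ C).
  - intros x Hx.
    refine (filterlim_comp _ _ _ _ (@norm _ V) _ _ _ (Hc x Hx) _).
    apply (@filterlim_norm _ V).
  - intros r Hr'; change (@norm _ _ ?x) with (Rabs x) at 1.
    rewrite Rabs_pos_eq by apply norm_ge_0; auto.
Qed.

Lemma hankel_correct (k : Z) (f : R -> V) (rho : R) :
  continuous_on_halfline f -> rapid f ->
  is_RInt_halfline (hankel_integrand k f rho) (hankel k f rho).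
Proof.
  intros Hf Hr; apply (RInt_gen_correct (V := V)).
  apply (hankel_integrable_rapid k f rho Hf Hr).
Qed.

Lemma RInt_halfline_unique (h : R -> V) (l l' : V) :
  is_RInt_halfline h l -> is_RInt_halfline h l' -> l = l'.
Proof.
  intros H H'; rewrite <- (is_RInt_gen_unique (V := V) h l H).
  now apply is_RInt_gen_unique.
Qed.

Lemma hankel_ext (k : Z) (f g : R -> V) (rho : R) :
  continuous_on_halfline f -> rapid f -> (forall r, 0 <= r -> f r = g r) ->
  hankel k f rho = hankel k g rho.
Proof.
  intros Hf Hr E; symmetry; apply is_RInt_gen_unique.
  apply RInt_halfline_ext with (hankel_integrand k f rho); [|now apply hankel_correct].
  intros r Hr'; unfold hankel_integrand; now rewrite E.
Qed.

Lemma hankel_bounded (k : Z) (f : R -> V) :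
  continuous_on_halfline f -> rapid f -> exists M, forall rho, norm (hankel k f rho) <= M.
Proof.
  intros Hf Hr; destruct (bessel_J_bounded k) as (C & HC & HJ).
  destruct (rapid_pow_dominated 1 f Hr) as (M & HM & HMr).
  exists (C * M); intros rho.
  apply norm_RInt_halfline_le with (hankel_integrand k f rho); [|now apply hankel_correct].
  intros r Hr'; eapply Rle_trans; [apply norm_scal_le|].
  rewrite Rabs_mult, (Rabs_pos_eq r), Rmult_assoc by trivial.
  replace (C * M / (1 + r) ^ 2) with (C * (M / (1 + r) ^ 2)) by (unfold Rdiv; ring).
  specialize (HMr r Hr'); rewrite pow_1 in HMr.
  apply Rmult_le_compat; auto using Rabs_pos.
  apply Rmult_le_pos; trivial; apply (@norm_ge_0 _ V).
Qed.

(** The integrand is identically zero because [J_k(0) = 0]. *)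
Lemma hankel_at_0 (k : Z) (f : R -> V) :
  k <> 0%Z -> continuous_on_halfline f -> rapid f -> hankel k f 0 = zero.
Proof.
  intros Hk Hf Hr; apply (norm_eq_zero (hankel k f 0)).
  apply Rle_antisym; [|apply norm_ge_0].
  apply norm_RInt_halfline_le with (hankel_integrand k f 0); [|now apply hankel_correct].
  intros r _; eapply Rle_trans; [apply norm_scal_le|].
  rewrite Rmult_0_l, bessel_J_at_0, Rmult_0_l, Rabs_R0 by trivial; unfold Rdiv; lra.
Qed.

(** [L] is any value of the differentiated integral, so that a caller can supply it already
    rewritten by a contiguity relation. *)
Lemma is_derive_hankel (k : Z) (f : R -> V) (x : R) (L : V) :
  continuous_on_halfline f -> rapid f ->
  is_RInt_halfline (fun r =>
    scal ((bessel_J (k - 1) (x * r) - bessel_J (k + 1) (x * r)) / 2 * r ^ 2) (f r)) L ->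
  is_derive (hankel k f) x L.
Proof.
  intros Hf Hr HL; destruct (bessel_J_taylor k) as (C & HC & HJ).
  (* Exponent 3: the Taylor remainder between [x r] and [y r] contributes [r^2], the measure [r dr]
     one more factor. *)
  destruct (rapid_pow_dominated 3 f Hr) as (M & HM & HMr).
  apply is_derive_of_quadratic with (C * M); intros y.
  replace (C * M * (y - x) ^ 2) with (C * (y - x) ^ 2 * M) by ring.
  eapply norm_RInt_halfline_le.
  2:{ apply @is_RInt_gen_minus; [typeclasses eauto..| |].
      - apply @is_RInt_gen_minus; [typeclasses eauto..| |]; now apply hankel_correct.
      - apply @is_RInt_gen_scal; [typeclasses eauto..|]; exact HL. }
  intros r Hr'; unfold hankel_integrand.
  rewrite (scal_lincomb (M := V)).
  match goal with |- context [scal ?a _] => replace a with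
    ((bessel_J k (y * r) - bessel_J k (x * r) - (y * r - x * r) *
      ((bessel_J (k - 1) (x * r) - bessel_J (k + 1) (x * r)) / 2)) * r) by field end.
  specialize (HJ (x * r) (y * r)); set (T := _ - _ - _) in *.
  eapply Rle_trans; [apply norm_scal_le|].
  rewrite Rabs_mult, (Rabs_pos_eq r) by trivial.
  apply Rle_trans with (C * (y - x) ^ 2 * (r ^ 3 * norm (f r))).
  - replace (C * (y - x) ^ 2 * (r ^ 3 * norm (f r))) with
      (C * (y * r - x * r) ^ 2 * r * norm (f r)) by ring.
    apply Rmult_le_compat_r; [apply (@norm_ge_0 _ V)|].
    now apply Rmult_le_compat_r.
  - replace (C * (y - x) ^ 2 * M / (1 + r) ^ 2) with
      (C * (y - x) ^ 2 * (M / (1 + r) ^ 2)) by (unfold Rdiv; ring).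
    apply Rmult_le_compat_l.
    { apply Rmult_le_pos; trivial; apply pow2_ge_0. }
    exact (HMr r Hr').
Qed.

End Hankel.

(** * The operators [D_j] and integration by parts *)

Lemma plus_minus_cancel {G : AbelianGroup} (u v : G) : plus (minus u v) v = u.
Proof. unfold minus; rewrite <- plus_assoc, plus_opp_l; apply plus_zero_r. Qed.

Lemma minus_plus_cancel {G : AbelianGroup} (u v : G) : minus (plus u v) v = u.
Proof.
  unfold minus; rewrite <- plus_assoc.
  change (plus v (opp v)) with (minus v v); rewrite minus_eq_zero; apply plus_zero_r.
Qed.

Lemma minus_plus_minus {G : AbelianGroup} (l u v : G) :
  minus (plus l (minus u v)) u = minus l v.
Proof.
  unfold minus; rewrite (plus_comm u), plus_assoc, <- plus_assoc.
  change (plus u (opp u)) with (minus u u); rewrite minus_eq_zero; apply plus_zero_r.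
Qed.

Lemma is_lim_inv_succ (c : R) : 0 <= c -> is_lim (fun b => c * / (1 + b)) p_infty 0.
Proof.
  intros Hc; apply is_lim_spec; intros [e He]; exists (c / e); intros b Hb; simpl.
  assert (0 <= c / e) by (apply Rmult_le_pos; trivial; apply Rlt_le, Rinv_0_lt_compat, He).
  rewrite Rminus_0_r, Rabs_pos_eq.
  - apply Rmult_lt_reg_r with (1 + b); [lra|].
    rewrite Rmult_assoc, Rinv_l, Rmult_1_r by lra.
    replace c with (c / e * e) by (field; lra); nra.
  - apply Rmult_le_pos; trivial; apply Rlt_le, Rinv_0_lt_compat; lra.
Qed.

Lemma plus_scal_minus {M : ModuleSpace R_Ring} (a c e : R) (v w : M) :
  plus (scal a v) (scal c (minus w (scal e v))) = plus (scal c w) (scal (a - c * e) v).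
Proof.
  rewrite scal_minus_distr_l, scal_assoc.
  rewrite (scal_minus_distr_r a (c * e) v : scal (a - c * e) v = _); unfold minus.
  rewrite !plus_assoc, (plus_comm (scal a v) (scal c w)); reflexivity.
Qed.

Section Step.

Context {V : CompleteNormedModule R_AbsRing}.

Lemma deriv_eq (f : R -> V) (r : R) (l : V) : is_derive f r l -> deriv f r = l.
Proof.
  intros H; apply iota_unique; trivial.
  intros y Hy; now apply is_derive_vec_unique with f r.
Qed.

(** The definition of [D_j] solved for [f'], the form in which derivatives enter the computations
    with [D_j]. *)
Lemma is_derive_D (j : Z) (f : R -> V) (r : R) : 0 < r -> ex_derive f r ->
  is_derive f r (minus (D j f r) (scal (IZR j / r) (f r))).
Proof.
  intros Hr [l Hl]; unfold D, extend0; destruct Rlt_dec; [|easy].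
  rewrite (deriv_eq f r l Hl).
  evar_last; [exact Hl|symmetry; exact (minus_plus_cancel (G := V) _ _)].
Qed.

Lemma is_derive_scal_vec (a : R -> R) (g : R -> V) (x da : R) (dg : V) :
  is_derive a x da -> is_derive g x dg ->
  is_derive (fun r => scal (a r) (g r)) x (plus (scal da (g x)) (scal (a x) dg)).
Proof.
  intros Ha Hg; unfold is_derive.
  eapply filterdiff_ext_lin.
  - apply (filterdiff_scal_fct x a g); [exact Rmult_comm|exact Ha|exact Hg].
  - intros y; simpl.
    rewrite (@scal_distr_l _ V), !(@scal_assoc _ V).
    now rewrite (Rmult_comm y (a x) : mult y (a x) = mult (a x) y).
Qed.

(** At [r > 0] this is uniqueness of the derivative; at [0] the extension is a right limit, which
    continuity of [h] identifies as [h 0]. The coefficient [j / r] is thus never examined at [0]. *)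
Lemma D_eq (j : Z) (f h : R -> V) :
  continuous_on_halfline h ->
  (forall r, 0 < r -> is_derive f r (minus (h r) (scal (IZR j / r) (f r)))) ->
  forall r, 0 <= r -> D j f r = h r.
Proof.
  intros Hh Hf.
  assert (Hpos : forall r, 0 < r ->
    plus (deriv f r) (scal (IZR j / r) (f r)) = h r).
  { intros r Hr; rewrite (deriv_eq f r _ (Hf r Hr)); exact (plus_minus_cancel (G := V) _ _). }
  intros r [Hr| <-]; unfold D, extend0; destruct Rlt_dec; try lra; [now apply Hpos|].
  apply (iota_filterlim_locally (V := V)).
  apply filterlim_ext_loc with h.
  - exists (mkposreal 1 Rlt_0_1); intros y _ Hy; symmetry; now apply Hpos.
  - intros P HP; destruct (Hh 0 (Rle_refl 0) P HP) as [d Hd].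
    exists d; intros y Hy Hy0; apply Hd; trivial; lra.
Qed.

(** The two functions may differ for negative arguments, but they agree near each [r > 0], and
    [D_eq] covers [r = 0]. *)
Lemma D_ext (j : Z) (f g : R -> V) :
  (forall r, 0 <= r -> f r = g r) -> (forall r, 0 < r -> ex_derive f r) ->
  continuous_on_halfline (D j f) -> forall r, 0 <= r -> D j f r = D j g r.
Proof.
  intros E Hd Hc r Hr; symmetry; revert r Hr; apply D_eq; trivial.
  intros r Hr; rewrite <- E by lra.
  apply is_derive_ext_loc with f; [|apply is_derive_D; auto].
  apply filter_imp with (fun y => 0 < y); [intros y Hy; apply E; lra|now apply open_gt].
Qed.

(** [Phi] need not be differentiable at [0]: the fundamental theorem is applied on [[d, b]], and
    both the integral over [[0, d]] and [Phi d] are at most [C d]. *)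
Lemma is_RInt_halfline_derive (Phi h : R -> V) (C b : R) (z : V) :
  continuous_on_halfline h ->
  (forall r, 0 <= r -> norm (h r) <= C / (1 + r) ^ 2) ->
  (forall r, 0 < r -> is_derive Phi r (h r)) ->
  (forall r, 0 <= r -> norm (Phi r) <= C * r) ->
  0 < b -> is_RInt h 0 b z -> z = Phi b.
Proof.
  intros Hc HC Hd HPhi Hb Hz.
  pose proof (dominated_const_nonneg h C HC) as HC0.
  apply eq_of_minus_zero, (norm_eq_zero (minus z (Phi b))), Rle_antisym; [|apply norm_ge_0].
  apply le_epsilon; intros e He; rewrite Rplus_0_l.
  set (d := Rmin b (e / (2 * C + 1))).
  assert (Hd0 : 0 < d) by (apply Rmin_pos; trivial; apply Rdiv_lt_0_compat; lra).
  assert (Hdb : d <= b) by apply Rmin_l.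
  assert (Hde : d * (2 * C + 1) <= e).
  { apply Rle_trans with (e / (2 * C + 1) * (2 * C + 1)); [|right; field; lra].
    apply Rmult_le_compat_r; [lra|apply Rmin_r]. }
  assert (Hl : is_RInt h 0 d (RInt h 0 d)).
  { apply (RInt_correct (V := V)), ex_RInt_of_halfline; trivial; lra. }
  assert (Hr : is_RInt h d b (minus (Phi b) (Phi d))).
  { apply (is_RInt_derive (V := V)); rewrite Rmin_left, Rmax_right by lra; intros r Hr.
    - apply Hd; lra.
    - apply continuous_pos_of_halfline; trivial; lra. }
  assert (E : z = plus (RInt h 0 d) (minus (Phi b) (Phi d))).
  { rewrite <- (is_RInt_unique _ _ _ _ Hz); apply (is_RInt_unique (V := V)).
    exact (is_RInt_Chasles h 0 d b _ _ Hl Hr). }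
  rewrite E; replace (minus _ (Phi b)) with (minus (RInt h 0 d) (Phi d))
    by (symmetry; exact (minus_plus_minus (G := V) _ _ _)).
  eapply Rle_trans; [apply norm_minus_le|].
  specialize (HPhi d (Rlt_le _ _ Hd0)).
  assert (norm (RInt h 0 d) <= C / (1 + 0) - C / (1 + d)).
  { apply norm_is_RInt_dominated with h; trivial; lra. }
  assert (C / (1 + 0) - C / (1 + d) <= C * d).
  { replace (C / (1 + 0) - C / (1 + d)) with (C * d * / (1 + d)) by (field; lra).
    rewrite <- (Rmult_1_r (C * d)) at 2; apply Rmult_le_compat_l; [nra|].
    rewrite <- Rinv_1; apply Rinv_le_contravar; lra. }
  lra.
Qed.

(* The boundary terms of [r A(r) g(r)] vanish at [0] because of the factor [r],
   and at infinity because [g] decays. *)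
Lemma RInt_halfline_by_parts (j : Z) (g : R -> V) (A B : R -> R) (C : R) :
  continuous_on_halfline g -> rapid g -> (forall r, 0 < r -> ex_derive g r) ->
  continuous_on_halfline (D j g) -> rapid (D j g) ->
  (forall x, continuous A x) -> (forall x, continuous B x) ->
  (forall r, 0 <= r -> Rabs (A r) <= C) -> (forall r, 0 <= r -> Rabs (B r) <= C * r ^ 1) ->
  (forall r, 0 < r -> is_derive (fun r => r * A r) r (IZR j * A r + B r)) ->
  is_RInt_halfline (fun r => plus (scal (A r * r) (D j g r)) (scal (B r) (g r))) zero.
Proof.
  intros Hg Hgr Hgd HD HDr HA HB HAC HBC HAB.
  set (h := fun r => plus (scal (A r * r) (D j g r)) (scal (B r) (g r))).
  assert (HhAr : forall x, continuous (fun r => A r * r) x).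
  { intros x; apply (continuous_mult A (fun r => r)); [apply HA|apply continuous_id]. }
  assert (Hhc : continuous_on_halfline h).
  { apply continuous_on_halfline_plus; now apply continuous_on_halfline_scal. }
  assert (Hhr : rapid h).
  { apply rapid_plus; [apply rapid_scal with C 1%nat|apply rapid_scal with C 1%nat]; trivial.
    intros r Hr; rewrite Rabs_mult, (Rabs_pos_eq r), pow_1 by trivial.
    now apply Rmult_le_compat_r; [|apply HAC]. }
  destruct (rapid_dominated h Hhr) as (K & HK).
  destruct (ex_RInt_halfline h K Hhc HK) as [l Hl].
  enough (E : l = zero) by (rewrite <- E; exact Hl).
  set (Phi := fun r => scal (r * A r) (g r)).
  assert (HPhi : forall r, 0 < r -> is_derive Phi r (h r)).
  { intros r Hr; unfold Phi, h.
    pose proof (is_derive_scal_vec _ g r _ _ (HAB r Hr) (is_derive_D j g r Hr (Hgd r Hr))) as H.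
    rewrite (plus_scal_minus (M := V)) in H.
    rewrite (Rmult_comm (A r) r).
    (* The term [j A] of [(r A)'] cancels the singular [r A (j / r)] that comes from
       [g' = D_j g - (j / r) g]. *)
    replace (B r) with (IZR j * A r + B r - r * A r * (IZR j / r)) at 1 by (field; lra).
    exact H. }
  assert (HC0 : 0 <= C) by (eapply Rle_trans; [apply Rabs_pos|apply (HAC 0 (Rle_refl 0))]).
  assert (HPhin : forall r, 0 <= r -> norm (Phi r) <= C * (r ^ 1 * norm (g r))).
  { intros r Hr; eapply Rle_trans; [apply norm_scal_le|].
    rewrite Rabs_mult, (Rabs_pos_eq r), pow_1, <- Rmult_assoc, (Rmult_comm C) by trivial.
    apply Rmult_le_compat_r; [apply (@norm_ge_0 _ V)|].
    apply Rmult_le_compat_l; auto. }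
  destruct (rapid_pow_dominated 1 g Hgr) as (G1 & HG10 & HG1).
  destruct (Hgr 0%nat) as (G0 & HG0).
  apply (norm_eq_zero l), Rle_antisym; [|apply norm_ge_0].
  apply norm_RInt_halfline_le_lim with h (fun b => C * G1 * / (1 + b)); trivial.
  - intros b z Hb Hz.
    (* One constant for both requirements: [K] dominates [h], and [C * G0] bounds [Phi r / r]. *)
    rewrite (is_RInt_halfline_derive Phi h (Rmax K (C * G0)) b z); trivial.
    + eapply Rle_trans; [apply HPhin; lra|].
      rewrite Rmult_assoc; apply Rmult_le_compat_l; trivial.
      eapply Rle_trans; [apply HG1; lra|].
      apply Rmult_le_compat_l; trivial.
      apply Rinv_le_contravar; nra.
    + intros r Hr; eapply Rle_trans; [now apply HK|].
      apply Rmult_le_compat_r; [|apply Rmax_l].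
      apply Rlt_le, Rinv_0_lt_compat, pow_lt; lra.
    + intros r Hr; eapply Rle_trans; [now apply HPhin|].
      apply Rle_trans with (C * G0 * r); [|apply Rmult_le_compat_r; trivial; apply Rmax_r].
      specialize (HG0 r Hr); rewrite Rmult_1_l in HG0.
      rewrite pow_1, (Rmult_comm r), <- Rmult_assoc.
      apply Rmult_le_compat_r; trivial; now apply Rmult_le_compat_l.
  - apply is_lim_inv_succ, Rmult_le_pos; trivial.
Qed.

End Step.

(** * Action of [D_j] on the Hankel transform *)

Lemma minus_scal_scal {M : ModuleSpace R_Ring} (a b c d : R) (v : M) :
  minus (scal a (scal b v)) (scal c (scal d v)) = scal (a * b - c * d) v.
Proof. rewrite !scal_assoc, <- scal_minus_distr_r; reflexivity. Qed.

Lemma scal_opp_eq {M : ModuleSpace R_Ring} (c : R) (u v : M) :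
  plus u (scal (- c) v) = zero -> u = scal c v.
Proof.
  intros E; apply eq_of_minus_zero; etransitivity; [|exact E].
  unfold minus; f_equal; symmetry; exact (scal_opp_l c v).
Qed.

Lemma plus_minus_minus {G : AbelianGroup} (u v x y : G) :
  plus (minus u x) (minus v y) = minus (plus u v) (plus x y).
Proof.
  unfold minus; transitivity (plus (plus u v) (plus (opp x) (opp y))).
  - rewrite <- !plus_assoc; f_equal; rewrite !plus_assoc; f_equal; apply plus_comm.
  - f_equal; symmetry; exact (opp_plus x y).
Qed.

Lemma plus_minus_scal {M : ModuleSpace R_Ring} (c : R) (u v x y : M) :
  plus (minus u (scal c x)) (minus v (scal c y)) = minus (plus u v) (scal c (plus x y)).
Proof. rewrite scal_distr_l; apply (plus_minus_minus (G := M)). Qed.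

(** With [v = g r] and [u = D_j g r], the algebra behind [D_(j+1) (r g) = r D_j g + 2 g]; the next
    lemma is its counterpart for [D_(j-1) (r g) = r D_j g]. *)
Lemma scal_mult_var_up {M : ModuleSpace R_Ring} (r j : R) (u v : M) : r <> 0 ->
  plus (scal 1 v) (scal r (minus u (scal (j / r) v)))
  = minus (plus (scal r u) (plus v v)) (scal ((j + 1) / r) (scal r v)).
Proof.
  intros Hr; rewrite plus_scal_minus; unfold minus; rewrite <- plus_assoc; f_equal.
  transitivity (scal (1 + 1 - (j + 1) / r * r) v); [f_equal; field; exact Hr|].
  etransitivity; [exact (scal_minus_distr_r (1 + 1) ((j + 1) / r * r) v)|].
  unfold minus; f_equal.
  - etransitivity; [exact (scal_distr_r 1 1 v)|f_equal; exact (scal_one v)].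
  - f_equal; symmetry; exact (scal_assoc ((j + 1) / r) r v).
Qed.

Lemma scal_mult_var_down {M : ModuleSpace R_Ring} (r j : R) (u v : M) : r <> 0 ->
  plus (scal 1 v) (scal r (minus u (scal (j / r) v)))
  = minus (scal r u) (scal ((j - 1) / r) (scal r v)).
Proof.
  intros Hr; rewrite plus_scal_minus; unfold minus; f_equal.
  transitivity (scal (- ((j - 1) / r * r)) v); [f_equal; field; exact Hr|].
  etransitivity; [exact (scal_opp_l ((j - 1) / r * r) v)|].
  f_equal; symmetry; exact (scal_assoc ((j - 1) / r) r v).
Qed.

Section Main.

Context {V : CompleteNormedModule R_AbsRing}.

Lemma ex_derive_hankel (k : Z) (f : R -> V) (x : R) :
  continuous_on_halfline f -> rapid f -> ex_derive (hankel k f) x.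
Proof.
  intros Hf Hr.
  destruct (bessel_J_bounded (k - 1)) as (C1 & HC1 & H1).
  destruct (bessel_J_bounded (k + 1)) as (C2 & HC2 & H2).
  destruct (ex_RInt_weighted (fun r =>
      (bessel_J (k - 1) (x * r) - bessel_J (k + 1) (x * r)) / 2 * r ^ 2)
    (C1 + C2) 2 f) as [L HL]; trivial.
  - intros r.
    apply continuous_ext with (fun r => / 2 *
      (bessel_J (k - 1) (x * r) * r ^ 2 - bessel_J (k + 1) (x * r) * r ^ 2)).
    { intros y; eq_R; field. }
    apply (continuous_scal_r (/ 2) (fun r =>
      bessel_J (k - 1) (x * r) * r ^ 2 - bessel_J (k + 1) (x * r) * r ^ 2)).
    apply (continuous_minus (fun r => bessel_J (k - 1) (x * r) * r ^ 2)
      (fun r => bessel_J (k + 1) (x * r) * r ^ 2)); apply continuous_bessel_J_weight.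
  - intros r Hr'; rewrite Rabs_mult, (Rabs_pos_eq (r ^ 2)) by apply pow2_ge_0.
    apply Rmult_le_compat_r; [apply pow2_ge_0|].
    specialize (H1 (x * r)); specialize (H2 (x * r)).
    apply Rabs_le_between in H1, H2; apply Rabs_le; lra.
  - exists L; now apply is_derive_hankel.
Qed.

Lemma continuous_on_hankel (k : Z) (f : R -> V) :
  continuous_on_halfline f -> rapid f -> continuous_on_halfline (hankel k f).
Proof.
  intros Hf Hr; apply continuous_on_forall; intros x _.
  apply (@ex_derive_continuous _ V), ex_derive_hankel; trivial.
Qed.

Lemma continuous_on_monomial (c : R) (n : nat) (f : R -> V) :
  continuous_on_halfline f -> continuous_on_halfline (fun r => scal (c * r ^ n) (f r)).
Proof.
  intros Hf; apply continuous_on_halfline_scal; trivial.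
  intros x; apply (ex_derive_continuous (fun r => c * r ^ n)); auto_derive; trivial.
Qed.

Lemma rapid_monomial (c : R) (n : nat) (f : R -> V) :
  rapid f -> rapid (fun r => scal (c * r ^ n) (f r)).
Proof.
  intros Hf; apply rapid_scal with (Rabs c) n; trivial.
  intros r Hr; rewrite Rabs_mult, (Rabs_pos_eq (r ^ n)) by (now apply pow_le); lra.
Qed.

Lemma hankel_scal (k : Z) (c : R) (n : nat) (f : R -> V) (rho : R) :
  continuous_on_halfline f -> rapid f ->
  hankel k (fun r => scal (c * r ^ n) (f r)) rho
  = scal c (hankel k (fun r => scal (r ^ n) (f r)) rho).
Proof.
  intros Hf Hr; apply is_RInt_gen_unique.
  apply RInt_halfline_ext with
    (fun r => scal c (hankel_integrand k (fun r => scal (r ^ n) (f r)) rho r)).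
  - intros r _; unfold hankel_integrand; rewrite !(@scal_assoc _ V).
    f_equal; repeat change (@mult _ ?a ?b) with (Rmult a b); eq_R; ring.
  - apply @is_RInt_gen_scal; [typeclasses eauto..|]; apply hankel_correct.
    + apply continuous_on_ext with (fun r => scal (1 * r ^ n) (f r)).
      { intros; now rewrite Rmult_1_l. }
      now apply continuous_on_monomial.
    + apply rapid_ext with (fun r => scal (1 * r ^ n) (f r)).
      { intros; now rewrite Rmult_1_l. }
      now apply rapid_monomial.
Qed.

(** Both contiguity relations at once, multiplied by [y]: [(j, m', s)] is [(m, m-1, 1)] or
    [(-m, m+1, -1)]. Asking [u] to be a Hankel transform only on [r >= 0] allows iteration. *)
Lemma D_hankel (j m m' : Z) (s : R) (g u : R -> V) :
  (forall y, (bessel_J (m - 1) y - bessel_J (m + 1) y) / 2 * y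
             = s * y * bessel_J m' y - IZR j * bessel_J m y) ->
  continuous_on_halfline g -> rapid g ->
  (forall r, 0 <= r -> u r = hankel m g r) ->
  forall r, 0 <= r -> D j u r = hankel m' (fun x => scal (s * x ^ 1) (g x)) r.
Proof.
  intros HJ Hg Hr Hu.
  assert (Hg1 := continuous_on_monomial s 1 g Hg).
  assert (Hr1 := rapid_monomial s 1 g Hr).
  apply D_eq; [now apply continuous_on_hankel|].
  intros r Hr0; rewrite Hu by lra.
  apply is_derive_ext_loc with (hankel m g).
  { apply filter_imp with (fun y => 0 < y); [intros y Hy; symmetry; apply Hu; lra|].
    now apply open_gt. }
  apply is_derive_hankel; trivial.
  eapply RInt_halfline_ext.
  2:{ apply @is_RInt_gen_minus; [typeclasses eauto..| |].
      - apply hankel_correct; trivial.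
      - apply @is_RInt_gen_scal; [typeclasses eauto..|]; now apply hankel_correct. }
  intros x _; unfold hankel_integrand; rewrite (minus_scal_scal (M := V)).
  f_equal; specialize (HJ (r * x)).
  (* The relation at [y = r x], times [x / r], restores the weight [x^2] of the differentiated
     integrand. *)
  transitivity ((s * (r * x) * bessel_J m' (r * x) - IZR j * bessel_J m (r * x)) * (x / r));
    [field; lra|rewrite <- HJ; field; lra].
Qed.

Lemma D_hankel_down (m : Z) (c : R) (n : nat) (f u : R -> V) :
  continuous_on_halfline f -> rapid f ->
  (forall r, 0 <= r -> u r = hankel m (fun x => scal (c * x ^ n) (f x)) r) ->
  forall r, 0 <= r -> D m u r = hankel (m - 1) (fun x => scal (c * x ^ S n) (f x)) r.
Proof.
  intros Hf Hr Hu r Hr0.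
  pose proof (continuous_on_monomial c n f Hf) as Hf1.
  pose proof (rapid_monomial c n f Hr) as Hr1.
  rewrite (D_hankel m m (m - 1) 1 _ u) with (4 := Hu); trivial.
  - apply hankel_ext; [now apply continuous_on_monomial|now apply rapid_monomial|].
    intros x _; rewrite (@scal_assoc _ V); f_equal.
    repeat change (@mult _ ?a ?b) with (Rmult a b); simpl; eq_R; ring.
  - intros y; pose proof (bessel_J_recurrence m y); lra.
Qed.

Lemma D_hankel_up (m : Z) (c : R) (n : nat) (f u : R -> V) :
  continuous_on_halfline f -> rapid f ->
  (forall r, 0 <= r -> u r = hankel m (fun x => scal (c * x ^ n) (f x)) r) ->
  forall r, 0 <= r ->
    D (- m) u r = hankel (m + 1) (fun x => scal (- c * x ^ S n) (f x)) r.
Proof.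
  intros Hf Hr Hu r Hr0.
  pose proof (continuous_on_monomial c n f Hf) as Hf1.
  pose proof (rapid_monomial c n f Hr) as Hr1.
  rewrite (D_hankel (- m) m (m + 1) (-1) _ u) with (4 := Hu); trivial.
  - apply hankel_ext; [now apply continuous_on_monomial|now apply rapid_monomial|].
    intros x _; rewrite (@scal_assoc _ V); f_equal.
    repeat change (@mult _ ?a ?b) with (Rmult a b); simpl; eq_R; ring.
  - intros y; pose proof (bessel_J_recurrence m y); rewrite opp_IZR; lra.
Qed.

(** * Hankel transform of [D_j g] *)

(** Integration by parts with [A r = J_m'(rho r)] and [B r = - c r J_m(rho r)]; the hypothesis on
    Bessel functions is [(r A)' = j A + B]. The uses are [(j, m', c) = (m, m-1, rho)] and
    [(-m, m+1, -rho)]. *)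
Lemma hankel_D (j m m' : Z) (c rho : R) (g : R -> V) :
  (forall y, bessel_J m' (rho * y)
      + rho * y * ((bessel_J (m' - 1) (rho * y) - bessel_J (m' + 1) (rho * y)) / 2)
      = IZR j * bessel_J m' (rho * y) - c * y * bessel_J m (rho * y)) ->
  continuous_on_halfline g -> rapid g -> (forall r, 0 < r -> ex_derive g r) ->
  continuous_on_halfline (D j g) -> rapid (D j g) ->
  hankel m' (D j g) rho = scal c (hankel m g rho).
Proof.
  intros HJ Hg Hr Hd HD HDr.
  destruct (bessel_J_bounded m') as (C1 & HC1 & H1).
  destruct (bessel_J_bounded m) as (C2 & HC2 & H2).
  apply (scal_opp_eq (M := V)).
  apply (RInt_halfline_unique (fun r => plus (scal (bessel_J m' (rho * r) * r) (D j g r))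
    (scal (- c * (bessel_J m (rho * r) * r ^ 1)) (g r)))).
  - eapply RInt_halfline_ext.
    2:{ apply @is_RInt_gen_plus; [typeclasses eauto..| |].
        - now apply hankel_correct.
        - apply @is_RInt_gen_scal; [typeclasses eauto..|]; now apply hankel_correct. }
    intros r _; unfold hankel_integrand; rewrite (@scal_assoc _ V), pow_1; reflexivity.
  - apply RInt_halfline_by_parts with (Rmax C1 (Rabs c * C2)); trivial.
    + apply continuous_bessel_J_scaled.
    + intros x; apply (continuous_scal_r (- c) (fun r => bessel_J m (rho * r) * r ^ 1)).
      apply continuous_bessel_J_weight.
    + intros r _; eapply Rle_trans; [apply H1|apply Rmax_l].
    + intros r Hr0; rewrite !Rabs_mult, Rabs_Ropp, pow_1, (Rabs_pos_eq r), <- Rmult_assoc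
        by trivial.
      apply Rmult_le_compat_r; trivial.
      eapply Rle_trans; [|apply Rmax_r]; apply Rmult_le_compat_l; auto using Rabs_pos.
    + intros r _; eapply is_derive_value.
      * apply Derive.is_derive_mult; [apply is_derive_id|apply is_derive_bessel_J_scaled].
      * specialize (HJ r); change (@one _) with 1; lra.
Qed.

Lemma hankel_D_down (m : Z) (rho : R) (g : R -> V) :
  continuous_on_halfline g -> rapid g -> (forall r, 0 < r -> ex_derive g r) ->
  continuous_on_halfline (D m g) -> rapid (D m g) ->
  hankel (m - 1) (D m g) rho = scal rho (hankel m g rho).
Proof.
  apply hankel_D; intros y; pose proof (bessel_J_recurrence (m - 1) (rho * y)) as H.
  replace (m - 1 + 1)%Z with m in * by lia; rewrite minus_IZR in H; lra.
Qed.

Lemma hankel_D_up (m : Z) (rho : R) (g : R -> V) :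
  continuous_on_halfline g -> rapid g -> (forall r, 0 < r -> ex_derive g r) ->
  continuous_on_halfline (D (- m) g) -> rapid (D (- m) g) ->
  hankel (m + 1) (D (- m) g) rho = scal (- rho) (hankel m g rho).
Proof.
  apply hankel_D; intros y; pose proof (bessel_J_recurrence (m + 1) (rho * y)) as H.
  replace (m + 1 - 1)%Z with m in * by lia; rewrite plus_IZR in H; rewrite opp_IZR; lra.
Qed.

(* Unlike [schwartz], this involves only the index-lowering operators, which
   makes its stability under multiplication by [r] an easy induction. *)
Fixpoint lowerable (N : nat) (m : Z) (g : R -> V) : Prop :=
  continuous_on_halfline g /\ rapid g /\
  match N with
  | O => True
  | S N' => (forall r, 0 < r -> ex_derive g r) /\ lowerable N' (m - 1) (D m g)
  end.

Lemma lowerable_continuous (N : nat) (m : Z) (g : R -> V) :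
  lowerable N m g -> continuous_on_halfline g.
Proof. now destruct N; intros []. Qed.

Lemma lowerable_rapid (N : nat) (m : Z) (g : R -> V) : lowerable N m g -> rapid g.
Proof. now destruct N; intros (_ & ? & _). Qed.

Lemma lowerable_pred (N : nat) (m : Z) (g : R -> V) :
  lowerable (S N) m g -> lowerable N m g.
Proof.
  revert m g; induction N as [|N IH]; intros m g (Hc & Hr & Hd & HD); repeat split; trivial.
  now apply IH.
Qed.

Lemma ex_derive_ext_halfline (f g : R -> V) (r : R) :
  (forall r, 0 <= r -> f r = g r) -> 0 < r -> ex_derive f r -> ex_derive g r.
Proof.
  intros E Hr; apply ex_derive_ext_loc.
  apply filter_imp with (fun y => 0 < y); [intros y Hy; apply E; lra|now apply open_gt].
Qed.

Lemma lowerable_ext (N : nat) (m : Z) (f g : R -> V) :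
  (forall r, 0 <= r -> f r = g r) -> lowerable N m f -> lowerable N m g.
Proof.
  revert m f g; induction N as [|N IH]; intros m f g E (Hc & Hr & H); repeat split; trivial.
  1,3: now apply continuous_on_ext with f.
  1,2: now apply rapid_ext with f.
  - intros r Hr0; apply ex_derive_ext_halfline with f; trivial; now apply H.
  - apply IH with (D m f); [|apply H].
    apply D_ext; trivial; [apply H|].
    eapply lowerable_continuous; apply H.
Qed.

Lemma lowerable_plus (N : nat) (m : Z) (f g : R -> V) :
  lowerable N m f -> lowerable N m g -> lowerable N m (fun r => plus (f r) (g r)).
Proof.
  revert m f g; induction N as [|N IH];
    intros m f g (Hfc & Hfr & Hf) (Hgc & Hgr & Hg); repeat split.
  1,3: now apply continuous_on_halfline_plus.
  1,2: now apply rapid_plus.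
  - intros r Hr; apply (@ex_derive_plus _ V); [now apply Hf|now apply Hg].
  - destruct Hf as [Hfd Hf], Hg as [Hgd Hg].
    apply lowerable_ext with (fun r => plus (D m f r) (D m g r)); [|now apply IH].
    intros r Hr; symmetry; revert r Hr; apply D_eq.
    + apply continuous_on_halfline_plus; eapply lowerable_continuous; eassumption.
    + intros r Hr; evar_last.
      * apply (@is_derive_plus _ V); apply is_derive_D; [exact Hr|auto|exact Hr|auto].
      * exact (plus_minus_scal (M := V) _ _ _ _ _).
Qed.

(** * Multiplication by [r] *)

Lemma continuous_on_mult_var (g : R -> V) :
  continuous_on_halfline g -> continuous_on_halfline (fun r => scal r (g r)).
Proof. apply continuous_on_halfline_scal; intros x; apply continuous_id. Qed.

Lemma rapid_mult_var (g : R -> V) : rapid g -> rapid (fun r => scal r (g r)).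
Proof.
  apply rapid_scal with 1 1%nat; intros r Hr; rewrite Rabs_pos_eq by trivial; lra.
Qed.

Lemma is_derive_mult_var (m : Z) (g : R -> V) (r : R) : 0 < r -> ex_derive g r ->
  is_derive (fun r => scal r (g r)) r
    (plus (scal 1 (g r)) (scal r (minus (D m g r) (scal (IZR m / r) (g r))))).
Proof.
  intros Hr Hd; apply (is_derive_scal_vec (fun r => r)); [exact (@is_derive_id R_AbsRing r)|].
  now apply is_derive_D.
Qed.

Lemma D_mult_var_up (m : Z) (g : R -> V) :
  continuous_on_halfline g -> (forall r, 0 < r -> ex_derive g r) ->
  continuous_on_halfline (D m g) -> forall r, 0 <= r ->
  D (m + 1) (fun r => scal r (g r)) r = plus (scal r (D m g r)) (plus (g r) (g r)).
Proof.
  intros Hg Hd HD; apply D_eq.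
  - apply continuous_on_halfline_plus; [now apply continuous_on_mult_var|].
    now apply continuous_on_halfline_plus.
  - intros r Hr; evar_last; [apply (is_derive_mult_var m); auto|].
    rewrite plus_IZR; apply (scal_mult_var_up (M := V)); lra.
Qed.

Lemma D_mult_var_down (m : Z) (g : R -> V) :
  (forall r, 0 < r -> ex_derive g r) ->
  continuous_on_halfline (D m g) -> forall r, 0 <= r ->
  D (m - 1) (fun r => scal r (g r)) r = scal r (D m g r).
Proof.
  intros Hd HD; apply D_eq; [now apply continuous_on_mult_var|].
  intros r Hr; evar_last; [apply (is_derive_mult_var m); auto|].
  rewrite minus_IZR; apply (scal_mult_var_down (M := V)); lra.
Qed.

Lemma ex_derive_mult_var (g : R -> V) (r : R) :
  ex_derive g r -> ex_derive (fun r => scal r (g r)) r.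
Proof.
  intros [l Hl]; eexists.
  apply (is_derive_scal_vec (fun r => r)); [exact (@is_derive_id R_AbsRing r)|exact Hl].
Qed.

Lemma lowerable_mult_var_up (N : nat) (m : Z) (g : R -> V) :
  lowerable N m g -> lowerable N (m + 1) (fun r => scal r (g r)).
Proof.
  revert m g; induction N as [|N IH]; intros m g H.
  - destruct H as (Hc & Hr & _); repeat split;
      [now apply continuous_on_mult_var|now apply rapid_mult_var].
  (* The summand [2 g] of [D_(m+1) (r g)] must admit [N] operators starting at index [m]; [g] itself
     admits [N+1]. *)
  - pose proof (lowerable_pred N m g H) as HN.
    destruct H as (Hc & Hr & Hd & HD); split; [|split; [|split]].
    + now apply continuous_on_mult_var.
    + now apply rapid_mult_var.
    + intros r Hr0; apply ex_derive_mult_var; auto.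
    + replace (m + 1 - 1)%Z with (m - 1 + 1)%Z by lia.
      apply lowerable_ext with (fun r => plus (scal r (D m g r)) (plus (g r) (g r))).
      { intros r Hr0; symmetry; apply D_mult_var_up; trivial.
        eapply lowerable_continuous; eassumption. }
      apply lowerable_plus; [now apply IH|].
      replace (m - 1 + 1)%Z with m by lia; now apply lowerable_plus.
Qed.

Lemma lowerable_mult_var_down (N : nat) (m : Z) (g : R -> V) :
  lowerable N m g -> lowerable N (m - 1) (fun r => scal r (g r)).
Proof.
  revert m g; induction N as [|N IH]; intros m g H.
  - destruct H as (Hc & Hr & _); repeat split;
      [now apply continuous_on_mult_var|now apply rapid_mult_var].
  - destruct H as (Hc & Hr & Hd & HD); split; [|split; [|split]].
    + now apply continuous_on_mult_var.
    + now apply rapid_mult_var.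
    + intros r Hr0; apply ex_derive_mult_var; auto.
    + apply lowerable_ext with (fun r => scal r (D m g r)); [|now apply IH].
      intros r Hr0; symmetry; apply D_mult_var_down; trivial.
      eapply lowerable_continuous; eassumption.
Qed.

(** Each factor [r] may shift the index by [1] in either direction; [i] shifts down and [a] up give,
    for [n = i + a], the index [m + n - 2 i] of the transform whose decay is wanted. *)
Lemma lowerable_monomial (N i a : nat) (m : Z) (g : R -> V) :
  lowerable N m g ->
  lowerable N (m - Z.of_nat i + Z.of_nat a) (fun r => scal (r ^ (i + a)) (g r)).
Proof.
  intros Hg.
  assert (Hmul : forall (n : nat) (r : R), scal r (scal (r ^ n) (g r)) = scal (r ^ S n) (g r)).
  { intros n r; apply (@scal_assoc _ V). }
  induction a as [|a IHa].
  - rewrite Nat.add_0_r; simpl Z.of_nat; rewrite Z.add_0_r.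
    induction i as [|i IHi].
    + simpl Z.of_nat; rewrite Z.sub_0_r; apply lowerable_ext with g; trivial.
      intros r _; symmetry; apply (@scal_one _ V).
    + replace (m - Z.of_nat (S i))%Z with (m - Z.of_nat i - 1)%Z by lia.
      eapply lowerable_ext; [|apply lowerable_mult_var_down, IHi].
      intros r _; apply Hmul.
  - rewrite Nat.add_succ_r.
    replace (m - Z.of_nat i + Z.of_nat (S a))%Z with (m - Z.of_nat i + Z.of_nat a + 1)%Z by lia.
    eapply lowerable_ext; [|apply lowerable_mult_var_up, IHa].
    intros r _; apply Hmul.
Qed.

Lemma hankel_decay (N : nat) (m : Z) (g : R -> V) : lowerable N m g ->
  exists M, forall rho, 0 <= rho -> rho ^ N * norm (hankel m g rho) <= M.
Proof.
  revert m g; induction N as [|N IH]; intros m g (Hc & Hr & H).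
  - destruct (hankel_bounded m g Hc Hr) as [M HM].
    exists M; intros rho _; rewrite Rmult_1_l; apply HM.
  - destruct H as [Hd HD]; destruct (IH _ _ HD) as [M HM].
    exists M; intros rho Hrho; eapply Rle_trans; [|now apply (HM rho)].
    rewrite hankel_D_down; trivial;
      [|eapply lowerable_continuous; eassumption|eapply lowerable_rapid; eassumption].
    simpl pow; rewrite norm_scal_eq, Rabs_pos_eq by trivial; right; ring.
Qed.

(** * Iterated operators and the Schwartz spaces *)

Lemma Dmix_diag (k : Z) (i : nat) (f : R -> V) : Dmix k i i f = Dpow k i f.
Proof. unfold Dmix; now rewrite Nat.sub_diag. Qed.

(** Writing [n = i + a] avoids truncated subtraction. The outer operator is [D_(-m)] with
    [m = k - i + a = k + n - 2 i], exactly the order at which the raising relation applies. *)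
Lemma Dmix_succ (k : Z) (i a : nat) (f : R -> V) :
  Dmix k (i + S a) i f
  = D (- (k - Z.of_nat i + Z.of_nat a)) (Dmix k (i + a) i f).
Proof.
  unfold Dmix; replace (i + S a - i)%nat with (S a) by lia.
  replace (i + a - i)%nat with a by lia; simpl.
  f_equal; lia.
Qed.

(** Every operator contributes a factor [x], and only the [a] raising ones a sign. *)
Lemma Dmix_hankel (k : Z) (i a : nat) (f : R -> V) :
  continuous_on_halfline f -> rapid f -> forall r, 0 <= r ->
  Dmix k (i + a) i (hankel k f) r
  = hankel (k - Z.of_nat i + Z.of_nat a) (fun x => scal ((-1) ^ a * x ^ (i + a)) (f x)) r.
Proof.
  intros Hf Hr; induction a as [|a IHa].
  - rewrite Nat.add_0_r, Dmix_diag; simpl Z.of_nat; rewrite Z.add_0_r; simpl ((-1) ^ 0).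
    induction i as [|i IHi].
    + intros r _; simpl Dpow; simpl Z.of_nat; rewrite Z.sub_0_r.
      apply hankel_ext; trivial; intros x _; simpl.
      rewrite Rmult_1_l; symmetry; apply (@scal_one _ V).
    + replace (k - Z.of_nat (S i))%Z with (k - Z.of_nat i - 1)%Z by lia.
      now apply D_hankel_down.
  - rewrite Dmix_succ, Nat.add_succ_r.
    replace (k - Z.of_nat i + Z.of_nat (S a))%Z with (k - Z.of_nat i + Z.of_nat a + 1)%Z by lia.
    replace ((-1) ^ S a) with (- (-1) ^ a) by (simpl; ring).
    now apply D_hankel_up.
Qed.

Lemma schwartz_continuous (k : Z) (f : R -> V) (i a : nat) :
  schwartz k f -> continuous_on_halfline (Dmix k (i + a) i f).
Proof. intros Hf; apply (Hf (i + a)%nat i); lia. Qed.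

Lemma schwartz_rapid (k : Z) (f : R -> V) (i a : nat) :
  schwartz k f -> rapid (Dmix k (i + a) i f).
Proof. intros Hf; unfold rapid; apply (Hf (i + a)%nat i); lia. Qed.

Lemma schwartz_ex_derive (k : Z) (f : R -> V) (i a : nat) (r : R) :
  schwartz k f -> 0 < r -> ex_derive (Dmix k (i + a) i f) r.
Proof. intros Hf; apply (Hf (i + a)%nat i); lia. Qed.

Lemma hankel_Dmix (k : Z) (i a : nat) (f : R -> V) (rho : R) : schwartz k f ->
  hankel (k - Z.of_nat i + Z.of_nat a) (Dmix k (i + a) i f) rho
  = scal ((-1) ^ a * rho ^ (i + a)) (hankel k f rho).
Proof.
  intros Hf; induction a as [|a IHa].
  - induction i as [|i IHi].
    + simpl Z.of_nat; rewrite Z.sub_0_r, Z.add_0_r, Rmult_1_l.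
      symmetry; apply (@scal_one _ V).
    + pose proof (schwartz_continuous k f (S i) 0 Hf) as Hc.
      pose proof (schwartz_rapid k f (S i) 0 Hf) as Hr.
      pose proof (schwartz_continuous k f i 0 Hf) as Hc0.
      pose proof (schwartz_rapid k f i 0 Hf) as Hr0.
      pose proof (fun r => schwartz_ex_derive k f i 0 r Hf) as Hd0.
      rewrite Nat.add_0_r, Dmix_diag in *; simpl Z.of_nat in IHi |- *.
      replace (k - Z.pos (Pos.of_succ_nat i) + 0)%Z with (k - Z.of_nat i - 1)%Z by lia.
      rewrite Z.add_0_r in IHi; simpl Dpow in *.
      rewrite hankel_D_down, IHi by trivial.
      rewrite (@scal_assoc _ V); f_equal.
      repeat change (@mult _ ?a ?b) with (Rmult a b); simpl; eq_R; ring.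
  - pose proof (schwartz_continuous k f i (S a) Hf) as Hc.
    pose proof (schwartz_rapid k f i (S a) Hf) as Hr.
    rewrite Dmix_succ in *.
    replace (k - Z.of_nat i + Z.of_nat (S a))%Z with (k - Z.of_nat i + Z.of_nat a + 1)%Z by lia.
    rewrite hankel_D_up, IHa; trivial.
    + rewrite (@scal_assoc _ V), Nat.add_succ_r; f_equal.
      repeat change (@mult _ ?a ?b) with (Rmult a b); simpl; eq_R; ring.
    + now apply schwartz_continuous.
    + now apply schwartz_rapid.
    + intros r Hr0; now apply schwartz_ex_derive.
Qed.

(** The lowering chain is the diagonal [n = i] of the family [Dmix]; a general [i] lets the
    induction restart from [Dpow k (S i) f]. *)
Lemma schwartz_lowerable (k : Z) (f : R -> V) (N i : nat) :
  schwartz k f -> lowerable N (k - Z.of_nat i) (Dpow k i f).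
Proof.
  intros Hf; revert i; induction N as [|N IH]; intros i;
    pose proof (schwartz_continuous k f i 0 Hf) as Hc;
    pose proof (schwartz_rapid k f i 0 Hf) as Hr;
    pose proof (fun r => schwartz_ex_derive k f i 0 r Hf) as Hd;
    rewrite Nat.add_0_r, Dmix_diag in *; repeat split; trivial.
  replace (k - Z.of_nat i - 1)%Z with (k - Z.of_nat (S i))%Z by lia.
  exact (IH (S i)).
Qed.

Lemma hankel_schwartz (k : Z) (f : R -> V) : schwartz k f -> schwartz k (hankel k f).
Proof.
  intros Hf n i Hin.
  pose proof (schwartz_continuous k f 0 0 Hf) as Hc; rewrite Dmix_diag in Hc; simpl in Hc.
  pose proof (schwartz_rapid k f 0 0 Hf) as Hr; rewrite Dmix_diag in Hr; simpl in Hr.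
  replace n with (i + (n - i))%nat by lia; set (a := (n - i)%nat); clearbody a.
  pose proof (Dmix_hankel k i a f Hc Hr) as E.
  pose proof (continuous_on_monomial ((-1) ^ a) (i + a) f Hc) as Hc'.
  pose proof (rapid_monomial ((-1) ^ a) (i + a) f Hr) as Hr'.
  replace (k + Z.of_nat (i + a) - 2 * Z.of_nat i)%Z
    with (k - Z.of_nat i + Z.of_nat a)%Z by lia.
  repeat split.
  - intros r Hr0; eapply ex_derive_ext_halfline; [|exact Hr0|].
    + intros x Hx; symmetry; now apply E.
    + now apply ex_derive_hankel.
  - eapply continuous_on_ext; [|apply continuous_on_hankel; [exact Hc'|exact Hr']].
    intros x Hx; symmetry; now apply E.
  - rewrite E by lra.
    (* Either the scalar is zero or the transform of nonzero order vanishes at [0]. *)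
    destruct (Z.eq_dec (k - Z.of_nat i + Z.of_nat a) 0) as [->|Hk].
    + apply (@scal_zero_l _ V).
    + rewrite hankel_at_0 by trivial; apply (@scal_zero_r _ V).
  - intros l.
    pose proof (schwartz_lowerable k f l 0 Hf) as Hlow.
    simpl in Hlow; rewrite Z.sub_0_r in Hlow.
    (* The exponent [l] of the weight costs [l] lowering operators on [r^(i+a) f]. *)
    destruct (hankel_decay l _ _ (lowerable_monomial l i a k f Hlow)) as [M HM].
    exists M; intros r Hr0; rewrite E, hankel_scal by trivial.
    eapply Rle_trans; [|apply (HM r Hr0)].
    apply Rmult_le_compat_l; [now apply pow_le|].
    eapply Rle_trans; [apply norm_scal_le|]; rewrite pow_1_abs; lra.
Qed.

End Main.

Theorem lemma3p28 (X : CompleteNormedModule C_AbsRing) (k : Z) :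
  (forall f : R -> realify X, schwartz k f ->
     (forall rho : R, 0 <= rho -> hankel_integrable k f rho) /\
     schwartz k (hankel k f)) /\
  (forall f : R -> realify X, schwartz k f ->
   forall n i : nat, (i <= n)%nat ->
   forall rho : R, 0 <= rho ->
     (hankel_integrable (k + Z.of_nat n - 2 * Z.of_nat i)
        (fun r => scal (r ^ n) (f r)) rho /\
      Dmix k n i (hankel k f) rho =
      scal ((-1) ^ (n - i))
        (hankel (k + Z.of_nat n - 2 * Z.of_nat i)
           (fun r => scal (r ^ n) (f r)) rho)) /\
     (hankel_integrable (k + Z.of_nat n - 2 * Z.of_nat i)
        (Dmix k n i f) rho /\
      hankel (k + Z.of_nat n - 2 * Z.of_nat i) (Dmix k n i f) rho =
      scal ((-1) ^ (n - i) * rho ^ n) (hankel k f rho))).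
Proof.
  split; intros f Hf;
    pose proof (schwartz_continuous k f 0 0 Hf) as Hc; rewrite Dmix_diag in Hc; simpl in Hc;
    pose proof (schwartz_rapid k f 0 0 Hf) as Hr; rewrite Dmix_diag in Hr; simpl in Hr.
  - split; [intros rho _; now apply hankel_integrable_rapid|now apply hankel_schwartz].
  - intros n i Hin rho Hrho.
    replace n with (i + (n - i))%nat by lia; set (a := (n - i)%nat); clearbody a.
    replace (i + a - i)%nat with a by lia.
    replace (k + Z.of_nat (i + a) - 2 * Z.of_nat i)%Z
      with (k - Z.of_nat i + Z.of_nat a)%Z by lia.
    split; split.
    (* With [N = 0], [lowerable] reduces to continuity and rapid decay, here transferred from [f] to
       [r^n f]. *)
    + pose proof (schwartz_lowerable k f 0 0 Hf) as Hlow.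
      apply (lowerable_monomial 0 i a) in Hlow.
      apply hankel_integrable_rapid;
        [eapply lowerable_continuous|eapply lowerable_rapid]; exact Hlow.
    + etransitivity; [now apply Dmix_hankel|now apply hankel_scal].
    + apply hankel_integrable_rapid; [now apply schwartz_continuous|now apply schwartz_rapid].
    + now apply hankel_Dmix.
Qed.
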